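(* Let $\mathcal{L}$ be a finite congruence-uniform lattice. The core label order $\mathrm{CLO}(\mathcal{L})$ is a lattice if and only if $\mathcal{L}$ is spherical and has the intersection property.
   Context: For a finite lattice $\mathcal{L}=(L,\leq)$, $\mathcal{J}(\mathcal{L})$ denotes the set of join-irreducible elements; each $j\in\mathcal{J}(\mathcal{L})$ has a unique lower cover $j_*$. For a cover relation $u\lessdot v$, $\mathrm{cg}(u,v)$ is the finest lattice congruence in which $u,v$ are equivalent, and $\mathrm{cg}(j)=\mathrm{cg}(j_*,j)$; the join-irreducible elements of the congruence lattice are exactly the $\mathrm{cg}(j)$. A finite lattice is congruence-uniform if $j\mapsto\mathrm{cg}(j)$ is a bijection from $\mathcal{J}(\mathcal{L})$ onto the join-irreducible congruences, for both $\mathcal{L}$ and its dual. For a cover $u\lessdot v$, $j_{\mathrm{cg}(u,v)}$ denotes the unique $j\in\mathcal{J}(\mathcal{L})$ with $\mathrm{cg}(j)=\mathrm{cg}(u,v)$. The nucleus of $x$ is $x_\downarrow=\bigwedge\{y\mid y\lessdot x\}$; the core label set is $\Psi(x)=\{j_{\mathrm{cg}(u,v)}\mid x_\downarrow\le u\lessdot v\le x\}$ (empty for $x=\hat0$). The core label order is $\mathrm{CLO}(\mathcal{L})=(L,\sqsubseteq)$ with $x\sqsubseteq y$ iff $\Psi(x)\subseteq\Psi(y)$. $\mathcal{L}$ has the intersection property if for all $x,y\in L$ there exists $z\in L$ with $\Psi(x)\cap\Psi(y)=\Psi(z)$. A bounded poset is spherical if the order complex of its proper part (with $\hat0,\hat1$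 removed) is homotopy equivalent to a sphere. *)

(* Defs.v *)
From HB Require Import structures.
From mathcomp Require Import all_boot all_order all_algebra.
From mathcomp Require Import all_classical all_reals topology normedtype.

Set Implicit Arguments.
Unset Strict Implicit.
Unset Printing Implicit Defensive.

Import Order.TTheory GRing.Theory Num.Theory.
Import numFieldNormedType.Exports.

Section FiniteLattice.
Local Open Scope order_scope.
Context {d : Order.disp_t} (L : finTBLatticeType d).
Implicit Types (x y u v j : L).

Definition covers u v : bool :=
  (u < v) && [forall w : L, ~~ ((u < w) && (w < v))].

Definition join_irreducible j : bool :=
  (j != \bot) &&
  [forall x : L, forall y : L, (j == x `|` y) ==> (j == x) || (j == y)].

Definition JI : {set L} := [set j | join_irreducible j].

(* Meaningful for join-irreducible j only; see [lower_coverP]. *)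
Definition lower_cover j : L := odflt j [pick u | covers u j].

Definition is_congruence (E : {set L * L}) : bool :=
  [&& [forall x, (x, x) \in E],
      [forall x, forall y, ((x, y) \in E) ==> ((y, x) \in E)],
      [forall x, forall y, forall z,
         ((x, y) \in E) && ((y, z) \in E) ==> ((x, z) \in E)] &
      [forall x, forall x', forall y, forall y',
         ((x, x') \in E) && ((y, y') \in E) ==>
         ((x `&` y, x' `&` y') \in E) && ((x `|` y, x' `|` y') \in E)]].

Record congruence := Congruence {
  congruence_set :> {set L * L};
  congruence_axiom : is_congruence congruence_set }.

HB.instance Definition _ := [isSub for congruence_set].
HB.instance Definition _ := [Finite of congruence by <:].

Lemma congruenceP (E : {set L * L}) :
  reflect [/\ forall x, (x, x) \in E,
              forall x y, (x, y) \in E -> (y, x) \in E,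
              forall x y z, (x, y) \in E -> (y, z) \in E -> (x, z) \in E &
              forall x x' y y', (x, x') \in E -> (y, y') \in E ->
                (x `&` y, x' `&` y') \in E /\ (x `|` y, x' `|` y') \in E]
          (is_congruence E).
Proof.
apply: (iffP and4P) => -[rE sE tE cE]; split.
- exact/forallP.
- by move=> x y; exact/implyP/(forallP (forallP sE x)).
- move=> x y z xy yz.
  by move/forallP/(_ x)/forallP/(_ y)/forallP/(_ z): tE; rewrite xy yz.
- move=> x x' y y' xE yE; apply/andP.
  move/forallP/(_ x)/forallP/(_ x')/forallP/(_ y)/forallP/(_ y'): cE.
  by rewrite xE yE.
- exact/forallP.
- by apply/forallP=> x; apply/forallP=> y; apply/implyP/sE.
- apply/forallP=> x; apply/forallP=> y; apply/forallP=> z.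
  by apply/implyP=> /andP[]; exact: tE.
- apply/forallP=> x; apply/forallP=> x'; apply/forallP=> y; apply/forallP=> y'.
  by apply/implyP=> /andP[xE yE]; apply/andP/cE.
Qed.

Lemma diag_is_congruence : is_congruence [set p | p.1 == p.2].
Proof.
apply/congruenceP; split=> [x|x y|x y z|x x' y y']; rewrite !inE //=.
- by rewrite eq_sym.
- by move=> /eqP-> /eqP->.
- by move=> /eqP-> /eqP->.
Qed.

Lemma setT_is_congruence : is_congruence [set: L * L].
Proof. by apply/congruenceP; split=> *; rewrite !inE. Qed.

Lemma bigcap_is_congruence (P : pred congruence) :
  is_congruence (\bigcap_(E : congruence | P E) congruence_set E).
Proof.
apply/congruenceP; split.
- move=> x; apply/bigcapP => E _.
  by have /congruenceP[+ _ _ _] := congruence_axiom E; apply.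
- move=> x y /bigcapP xy; apply/bigcapP => E PE.
  by have /congruenceP[_ + _ _] := congruence_axiom E; apply; apply: xy.
- move=> x y z /bigcapP xy /bigcapP yz; apply/bigcapP => E PE.
  have /congruenceP[_ _ + _] := congruence_axiom E.
  by apply; [apply: xy | apply: yz].
- move=> x x' y y' /bigcapP hx /bigcapP hy.
  have h E : P E -> (x `&` y, x' `&` y') \in congruence_set E
                 /\ (x `|` y, x' `|` y') \in congruence_set E.
    move=> PE; have /congruenceP[_ _ _] := congruence_axiom E.
    by apply; [apply: hx | apply: hy].
  by split; apply/bigcapP => E /h[].
Qed.

Lemma setI_is_congruence (E F : congruence) :
  is_congruence (congruence_set E :&: congruence_set F).
Proof.
have /congruenceP[rE sE tE cE] := congruence_axiom E.
have /congruenceP[rF sF tF cF] := congruence_axiom F.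
apply/congruenceP; split.
- by move=> x; rewrite inE rE rF.
- by move=> x y /setIP[xE xF]; rewrite inE (sE _ _ xE) (sF _ _ xF).
- move=> x y z /setIP[xE xF] /setIP[yE yF].
  by rewrite inE (tE _ _ _ xE yE) (tF _ _ _ xF yF).
- move=> x x' y y' /setIP[xE xF] /setIP[yE yF]; rewrite !inE.
  by case: (cE _ _ _ _ xE yE) (cF _ _ _ _ xF yF) => -> -> [-> ->].
Qed.

Definition congruence_gen (S : {set L * L}) : congruence :=
  Congruence (bigcap_is_congruence (fun E => S \subset congruence_set E)).

Lemma congruence_genP (S : {set L * L}) (E : congruence) :
  (congruence_gen S \subset congruence_set E) = (S \subset congruence_set E).
Proof.
apply/idP/idP; last by move=> SE; exact: (finset.bigcap_inf E).
apply: fintype.subset_trans; apply/fintype.subsetP=> p pS.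
by apply/bigcapP=> F /fintype.subsetP; apply.
Qed.

Definition con_le (E F : congruence) : bool :=
  congruence_set E \subset congruence_set F.
Definition con_meet (E F : congruence) : congruence :=
  Congruence (setI_is_congruence E F).
Definition con_join (E F : congruence) : congruence :=
  congruence_gen (congruence_set E :|: congruence_set F).
Definition con_bot : congruence := Congruence diag_is_congruence.
Definition con_top : congruence := Congruence setT_is_congruence.

Fact con_le_refl : reflexive con_le. Proof. by move=> E; exact: fintype.subxx. Qed.
Fact con_le_anti : antisymmetric con_le.
Proof. by move=> E F EF; apply: val_inj; apply/eqP; rewrite finset.eqEsubset. Qed.
Fact con_le_trans : transitive con_le.
Proof. by move=> F E G; exact: fintype.subset_trans. Qed.
Fact con_display : Order.disp_t. Proof. exact: (Order.Disp tt tt). Qed.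

HB.instance Definition _ := Order.Le_isPOrder.Build con_display congruence
  con_le_refl con_le_anti con_le_trans.

Fact con_meetP (E F G : congruence) :
  (E <= con_meet F G) = (E <= F) && (E <= G).
Proof. exact: finset.subsetI. Qed.
Fact con_joinP (E F G : congruence) :
  (con_join E F <= G) = (E <= G) && (F <= G).
Proof. by rewrite /Order.le /= /con_le congruence_genP finset.subUset. Qed.

HB.instance Definition _ := Order.POrder_MeetJoin_isLattice.Build
  con_display congruence con_meetP con_joinP.

Fact con_bot_le (E : congruence) : con_bot <= E.
Proof.
apply/fintype.subsetP=> -[x y]; rewrite inE /= => /eqP->.
by have /congruenceP[+ _ _ _] := congruence_axiom E; apply.
Qed.
Fact con_le_top (E : congruence) : E <= con_top.
Proof. exact: finset.subsetT. Qed.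

HB.instance Definition _ :=
  Order.hasBottom.Build con_display congruence con_bot_le.
HB.instance Definition _ :=
  Order.hasTop.Build con_display congruence con_le_top.

Definition cg u v : congruence := congruence_gen [set (u, v)].
Definition cg_ji j : congruence := cg (lower_cover j) j.

End FiniteLattice.

Section CoreLabelOrder.
Local Open Scope order_scope.

Definition cg_bijective {d : Order.disp_t} (L : finTBLatticeType d) : Prop :=
  {in JI L &, injective (@cg_ji d L)} /\
  (@cg_ji d L) @: JI L = JI (congruence L).

Definition congruence_uniform {d : Order.disp_t} (L : finTBLatticeType d) :
  Prop := cg_bijective L /\ cg_bijective L^d.

Context {d : Order.disp_t} (L : finTBLatticeType d).
Implicit Types (x y u v j : L).

(* [is_label u v j] says j = j_{cg(u,v)}; in a congruence-uniform lattice, this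
   holds for exactly one j when v covers u. *)
Definition is_label u v j : bool := (j \in JI L) && (cg_ji j == cg u v).

(* The nucleus of \bot is \top (empty meet), so that [core_labels \bot] is
   empty; see [core_labels_bot]. *)
Definition nucleus x : L := \meet_(y | covers y x) y.

Definition core_labels x : {set L} :=
  [set j | [exists u : L, exists v : L,
     [&& nucleus x <= u, covers u v, v <= x & is_label u v j]]].

Definition CLO : rel L := fun x y => core_labels x \subset core_labels y.

Definition intersection_property : Prop :=
  forall x y, exists z, core_labels x :&: core_labels y = core_labels z.

Definition order_complex : {set {set L}} :=
  [set S : {set L} | [&& \bot \notin S, \top \notin S &
     [forall x in S, forall y in S, x >=< y]]].

Lemma lower_coverP j : j \in JI L ->
  forall u, covers u j = (u == lower_cover j).
Proof.
rewrite inE => /andP[jN0 /forallP jJ].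
have uniq u v : covers u j -> covers v j -> u = v.
  move=> /andP[uj /forallP uM] /andP[vj /forallP vM].
  have uvj : u `|` v <= j by rewrite leUx !ltW.
  have uvN : j != u `|` v.
    apply/negP => /(implyP (forallP (jJ u) v)).
    by rewrite !gt_eqF.
  have uv_lt : u `|` v < j by rewrite lt_neqAle eq_sym uvN.
  move: (uM (u `|` v)) (vM (u `|` v)); rewrite uv_lt !andbT !lt_neqAle.
  by rewrite leUl leUr !andbT !negbK => /eqP uE /eqP vE; rewrite uE -vE.
have [u uj] : exists u, covers u j.
  have b0 : \bot < j by rewrite lt0x.
  have [u uj umax] := @arg_maxnP L \bot (fun u => u < j)
    (fun u => #|[pred w | w <= u]|) b0.
  exists u; rewrite /covers uj; apply/forallP => w; apply/negP => /andP[uw wj].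
  have := umax w wj; rewrite /= leqNgt => /negP; apply.
  apply: proper_card; apply/properP; split.
    by apply/fintype.subsetP=> z; rewrite !inE => /le_trans; apply; exact: ltW.
  by exists w; rewrite !inE ?lexx // lt_geF.
rewrite /lower_cover; case: pickP => [v vj|/(_ u)]; last by rewrite uj.
by move=> w; apply/idP/eqP => [wj|-> //]; exact: uniq.
Qed.

Lemma core_labels_bot : core_labels \bot = finset.set0.
Proof.
apply/finset.setP=> j; rewrite !inE; apply/negbTE/negP.
move=> /existsP[u /existsP[v /and4P[_ /andP[uv _] v0 _]]].
by have := lt_le_trans uv v0; rewrite ltx0.
Qed.

End CoreLabelOrder.

Arguments CLO {d} L _ _.

Definition is_lattice (T : Type) (le : rel T) : Prop :=
  [/\ reflexive le, antisymmetric le, transitive le,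
      forall x y, exists m,
        forall z, le z m = le z x && le z y &
      forall x y, exists s,
        forall z, le s z = le x z && le y z].

Section Topology.
Local Open Scope classical_set_scope.
Local Open Scope ring_scope.
Variable R : realType.

Definition homotopic (X Y : topologicalType) (A : set X) (B : set Y)
    (f g : X -> Y) : Prop :=
  exists h : R * X -> Y,
    [/\ {within `[0, 1]%classic `*` A, continuous h},
        forall (t : R) (x : X), `[0, 1]%classic t -> A x -> B (h (t, x)),
        forall x, A x -> h (0, x) = f x &
        forall x, A x -> h (1, x) = g x].

Definition homotopy_equivalent (X Y : topologicalType)
    (A : set X) (B : set Y) : Prop :=
  exists (f : X -> Y) (g : Y -> X),
    [/\ {within A, continuous f} /\ (forall x, A x -> B (f x)),
        {within B, continuous g} /\ (forall y, B y -> A (g y)),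
        homotopic A A (g \o f) id &
        homotopic B B (f \o g) id].

(* The unit sphere of R^n, of dimension n - 1; it is empty for n = 0. *)
Definition sphere (n : nat) : set 'rV[R]_n :=
  [set v | \sum_(i < n) v 0 i ^+ 2 = 1].

Section Realization.
Variable V : finType.

(* The vertex x is the basis vector of R^V with index [enum_rank x]. *)
Definition vertex_support (v : 'rV[R]_#|V|) : {set V} :=
  [set x : V | v 0 (enum_rank x) != 0]%SET.

Definition realization (K : {set {set V}}) : set 'rV[R]_#|V| :=
  [set v : 'rV[R]_#|V| | [/\ forall i, 0 <= v 0 i, \sum_i v 0 i = 1 &
               vertex_support v \in K]].
End Realization.

(* Includes the (-1)-dimensional sphere: an empty proper part is spherical. *)
Definition spherical {d : Order.disp_t} (L : finTBLatticeType d) : Prop :=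
  exists n : nat,
    homotopy_equivalent (realization (order_complex L)) (@sphere n).

End Topology.

(* Main.v *)
Require Import Defs.
From mathcomp Require Import all_boot all_order all_algebra.
From mathcomp Require Import all_classical all_reals topology normedtype realfun.

(** If [u <. v], every minimal element below [v] and not below [u] is a
    join-irreducible inducing the congruence [cg u v].  Injectivity of [cg_ji]
    makes it unique, so it is the label [j] of the cover: [j <= v] and
    [~ j <= u].  It follows that [x] is the join of [core_labels x], that
    [core_labels j = {j}] for [j] join-irreducible, and that [CLO L] is a
    lattice iff intersections of core label sets are core label sets and all
    join-irreducibles are core labels of one element; the latter means that the
    nucleus of [\top] is [\bot].

    Let [c] be that nucleus and [P] the proper part of [L].  If [c] is not
    [\bot], then [x <= x \/ c >= c] contracts the order complex of [P] to a
    point, while spheres are not contractible.  The latter is deduced from the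
    Poincare-Miranda theorem, whose combinatorial core is a Stokes formula
    modulo 2 on a cubical grid.

    If [c = \bot], uniqueness of the label of [a <. \top] says that each
    coatom [a] is prime: [~ x <= a] iff [x] is above a fixed element.  Hence [x]
    is determined, up to the closure operator "meet of the coatoms above [x]",
    by the set of coatoms not above it, and these are all nontrivial subsets of
    the set of coatoms: the order complex retracts to the barycentric
    subdivision of the boundary of a simplex.  A point of the complex is sent
    to the function on coatoms summing the weights of the elements not below
    each coatom; modulo constants and positive scaling, nonconstant functions
    form a sphere, and the level sets of such a function give a map back.  All
    homotopies are given by explicit formulas. *)

Set Implicit Arguments.
Unset Strict Implicit.
Unset Printing Implicit Defensive.

Import Order.TTheory GRing.Theory Num.Theory.
Import numFieldNormedType.Exports.

(** * Labels and the core label order *)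

Section Labels.
Local Open Scope order_scope.
Context {d : Order.disp_t} (L : finTBLatticeType d).
Implicit Types (x y z u v w j : L).

Lemma ex_minimal_le (P : pred L) x : P x ->
  exists2 y, y <= x & P y /\ forall z, P z -> z <= y -> z = y.
Proof.
move=> Px.
have [|y /andP[yx Py] ymin] := @arg_minnP L x (fun y => (y <= x) && P y)
  (fun u => #|[pred w | w <= u]|).
  by rewrite lexx.
exists y => //; split=> // z Pz zy; apply/eqP; apply: contraTT isT => zNy.
have := ymin z; rewrite (le_trans zy yx) Pz => /(_ isT).
rewrite leqNgt => /negP[]; apply: proper_card; apply/properP; split.
  by apply/fintype.subsetP=> w; rewrite !inE => /le_trans; apply.
exists y; rewrite !inE ?lexx //; apply: contra zNy => yz.
by rewrite eq_le zy yz.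
Qed.

Lemma ex_maximal_ge (P : pred L) x : P x ->
  exists2 y, x <= y & P y /\ forall z, P z -> y <= z -> z = y.
Proof.
move=> Px.
have [|y /andP[yx Py] ymin] := @arg_minnP L x (fun y => (x <= y) && P y)
  (fun u => #|[pred w | u <= w]|).
  by rewrite lexx.
exists y => //; split=> // z Pz zy; apply/eqP; apply: contraTT isT => zNy.
have := ymin z; rewrite (le_trans yx zy) Pz => /(_ isT).
rewrite leqNgt => /negP[]; apply: proper_card; apply/properP; split.
  by apply/fintype.subsetP=> w; rewrite !inE; exact: le_trans.
exists y; rewrite !inE ?lexx //; apply: contra zNy => yz.
by rewrite eq_le zy yz.
Qed.

Lemma covers_lt u v : covers u v -> u < v.
Proof. by case/andP. Qed.

Lemma covers_between u v w : covers u v -> u < w -> w <= v -> w = v.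
Proof.
move=> /andP[_ /forallP/(_ w)]; rewrite negb_and => /orP[/negbTE->//|].
by rewrite lt_neqAle => + _ wv; rewrite wv andbT negbK => /eqP.
Qed.

Lemma ex_covers_ge x y : x < y -> exists2 u, x <= u & covers u y.
Proof.
move=> xy; have [u xu [uy umax]] := ex_maximal_ge (P := fun w => w < y) xy.
exists u => //; rewrite /covers uy; apply/forallP=> w; apply/negP=> /andP[uw wy].
by have := uw; rewrite (umax w wy (ltW uw)) ltxx.
Qed.

Lemma ex_covers_le x y : x < y -> exists2 u, u <= y & covers x u.
Proof.
move=> xy; have [u uy [xu umin]] := ex_minimal_le (P := fun w => x < w) xy.
exists u => //; rewrite /covers xu; apply/forallP=> w; apply/negP=> /andP[xw wu].
by have := wu; rewrite (umin w xw (ltW wu)) ltxx.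
Qed.

Lemma congruence_refl (E : congruence L) x : (x, x) \in congruence_set E.
Proof. by have /congruenceP[+ _ _ _] := congruence_axiom E; apply. Qed.

Lemma congruence_meetr (E : congruence L) x y z :
  (x, y) \in congruence_set E -> (x `&` z, y `&` z) \in congruence_set E.
Proof.
have /congruenceP[_ _ _ h] := congruence_axiom E.
by move=> /h/(_ (congruence_refl E z))[].
Qed.

Lemma congruence_joinr (E : congruence L) x y z :
  (x, y) \in congruence_set E -> (x `|` z, y `|` z) \in congruence_set E.
Proof.
have /congruenceP[_ _ _ h] := congruence_axiom E.
by move=> /h/(_ (congruence_refl E z))[].
Qed.

Lemma cg_le u v (E : congruence L) :
  (cg u v <= E) = ((u, v) \in congruence_set E).
Proof. by rewrite /Order.le /= /con_le congruence_genP finset.sub1set. Qed.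

Lemma mem_cg u v : (u, v) \in congruence_set (cg u v).
Proof. by rewrite -cg_le. Qed.

(** By minimality everything strictly below [j] lies below [u]. Hence [j] is join-irreducible, its
    meet with [u] is its lower cover and its join with [u] is [v]: the two covers are perspective
    and generate the same congruence. *)
Lemma is_label_minimal u v j : covers u v -> j <= v -> ~~ (j <= u) ->
  (forall z, ~~ (z <= u) -> z <= j -> z = j) -> is_label u v j.
Proof.
move=> uv jv jNu jmin; have jJ : j \in JI L.
  rewrite inE /join_irreducible; apply/andP; split.
    by apply: contraNneq jNu => ->; rewrite le0x.
  apply/forallP=> x; apply/forallP=> y; apply/implyP=> /eqP jE.
  have [xu|xNu] := boolP (x <= u); last first.
    by rewrite [x]jmin ?eqxx// jE leUl.
  have [yu|yNu] := boolP (y <= u); last first.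
    by rewrite [y]jmin ?eqxx ?orbT// jE leUr.
  by move: jNu; rewrite jE leUx xu yu.
have jc : covers (lower_cover j) j by rewrite lower_coverP.
have ju : lower_cover j <= u.
  apply: contraTT (covers_lt jc) => h.
  by rewrite [lower_cover j]jmin ?ltxx // ltW // covers_lt.
have mE : u `&` j = lower_cover j.
  apply/eqP; rewrite eq_le lexI ju (ltW (covers_lt jc)) andbT.
  apply: contraNT jNu => h.
  have lt1 : lower_cover j < u `&` j.
    rewrite lt_neqAle lexI ju (ltW (covers_lt jc)) !andbT.
    by apply: contraNneq h => e; rewrite -e lexx.
  by rewrite -(covers_between jc lt1 (leIr _ _)) leIl.
have sE : u `|` j = v.
  apply: (covers_between uv); last by rewrite leUx (ltW (covers_lt uv)).
  rewrite lt_neqAle leUl andbT; apply: contraNneq jNu => ->; exact: leUr.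
rewrite /is_label jJ; apply/eqP/le_anti; rewrite /cg_ji !cg_le.
have := congruence_meetr j (mem_cg u v).
have := congruence_joinr u (mem_cg (lower_cover j) j).
rewrite mE (meet_r jv) [j `|` u]joinC sE joinC.
by move/join_idPl: ju => -> -> ->.
Qed.

(** The freedom in [x] matters: once labels are unique, the label of the cover lies below every such
    [x]. *)
Lemma ex_minimal_label u v x : covers u v -> x <= v -> ~~ (x <= u) ->
  exists j, [/\ is_label u v j, j <= x & ~~ (j <= u)].
Proof.
move=> uv xv xNu.
have [j jx [jNu jmin]] := ex_minimal_le (P := fun z => ~~ (z <= u)) xNu.
by exists j; split=> //; apply: is_label_minimal => //; exact: le_trans xv.
Qed.

Lemma ex_label u v : covers u v -> exists j, is_label u v j.
Proof.
move=> uv; have [||j [jl _ _]] := ex_minimal_label uv (x := v) => //.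
  by rewrite lt_geF // covers_lt.
by exists j.
Qed.

Lemma nucleus_le u x : covers u x -> nucleus x <= u.
Proof. by move=> ux; apply: meets_inf. Qed.

Lemma mem_core_labels u v x j : nucleus x <= u -> covers u v -> v <= x ->
  is_label u v j -> j \in core_labels x.
Proof.
by move=> h1 h2 h3 h4; rewrite inE; apply/existsP; exists u; apply/existsP;
  exists v; rewrite h1 h2 h3.
Qed.

Lemma core_labelsP x j : reflect (exists u v, [/\ nucleus x <= u, covers u v,
  v <= x & is_label u v j]) (j \in core_labels x).
Proof.
rewrite inE; apply: (iffP existsP) => [[u /existsP[v /and4P[]]]|[u [v []]]].
  by exists u, v.
by exists u; apply/existsP; exists v; apply/and4P.
Qed.

Lemma core_labels_sub_JI x : core_labels x \subset JI L.
Proof. by apply/fintype.subsetP=> j /core_labelsP[u [v [_ _ _ /andP[]]]]. Qed.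

Lemma lower_cover_covers j : j \in JI L -> covers (lower_cover j) j.
Proof. by move=> jJ; rewrite lower_coverP. Qed.

Lemma ji_is_label j : j \in JI L -> is_label (lower_cover j) j j.
Proof. by move=> jJ; rewrite /is_label jJ /=. Qed.

Lemma ji_in_core_labels j : j \in JI L -> j \in core_labels j.
Proof.
move=> jJ; apply: (mem_core_labels _ (lower_cover_covers jJ) (lexx j)).
  exact/nucleus_le/lower_cover_covers.
exact: ji_is_label.
Qed.

Lemma nucleus_ji j : j \in JI L -> nucleus j = lower_cover j.
Proof.
move=> jJ; apply/le_anti/andP; split; first exact/nucleus_le/lower_cover_covers.
by apply/meetsP => u; rewrite lower_coverP // => /eqP->.
Qed.

Lemma coatom_ge x : x < \top -> exists2 c, x <= c & covers c (\top : L).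
Proof. exact: ex_covers_ge. Qed.

(** With nucleus [\bot], every cover of the lattice counts for [\top], in particular the one below
    each join-irreducible. *)
Lemma core_labels_top_bot : nucleus \top = \bot :> L ->
  core_labels \top = JI L.
Proof.
move=> n0; apply/eqP; rewrite finset.eqEsubset core_labels_sub_JI /=.
apply/fintype.subsetP=> j jJ.
apply: (mem_core_labels _ (lower_cover_covers jJ) (lex1 j) (ji_is_label jJ)).
by rewrite n0 le0x.
Qed.

(** * Consequences of the uniqueness of labels *)

Section Injective.
Hypothesis cg_inj : {in JI L &, injective (@cg_ji d L)}.

Lemma is_label_unique u v j j' : is_label u v j -> is_label u v j' -> j = j'.
Proof.
by move=> /andP[jJ /eqP jE] /andP[j'J /eqP j'E]; apply: cg_inj; rewrite ?jE.
Qed.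

Lemma label_le u v j : covers u v -> is_label u v j -> j <= v.
Proof.
move=> uv jl; have [||j' [jl' jv _]] := ex_minimal_label uv (x := v) => //.
  by rewrite lt_geF // covers_lt.
by rewrite (is_label_unique jl jl').
Qed.

Lemma label_Nle u v j : covers u v -> is_label u v j -> ~~ (j <= u).
Proof.
move=> uv jl; have [||j' [jl' _ jv]] := ex_minimal_label uv (x := v) => //.
  by rewrite lt_geF // covers_lt.
by rewrite (is_label_unique jl jl').
Qed.

(** The unique label of the cover of [c] by [\top] is the least element not below [c]: each such
    element dominates a minimal one, which is a label. *)
Lemma coatom_prime c : covers c (\top : L) -> exists j, forall x, (x <= c) = ~~ (j <= x).
Proof.
move=> cc; have [j jl] := ex_label cc; exists j => x.
have [xc|xNc] := boolP (x <= c).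
  by apply/esym; apply: contra (label_Nle cc jl) => /le_trans; apply.
have [j' [jl' jx _]] := ex_minimal_label cc (lex1 x) xNc.
by rewrite (is_label_unique jl jl') jx.
Qed.

(** The interval from the nucleus of [j] to [j] consists of a single cover. *)
Lemma core_labels_ji j : j \in JI L -> core_labels j = [set j]%SET.
Proof.
move=> jJ; apply/eqP; rewrite finset.eqEsubset finset.sub1set ji_in_core_labels //.
rewrite andbT; apply/fintype.subsetP=> i /core_labelsP[u [v [nu uv vj il]]].
move: nu; rewrite nucleus_ji // => nu.
have vE : v = j.
  apply: (covers_between (lower_cover_covers jJ) _ vj).
  exact: le_lt_trans nu (covers_lt uv).
have uE : u = lower_cover j.
  move: nu; rewrite le_eqVlt => /predU1P[//|nu].
  have := covers_lt uv.
  rewrite vE (covers_between (lower_cover_covers jJ) nu) ?ltxx //.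
  by rewrite -vE (ltW (covers_lt uv)).
by rewrite inE (is_label_unique il (_ : is_label u v j)) // uE vE ji_is_label.
Qed.

Lemma core_labels_le x j : j \in core_labels x -> j <= x.
Proof. by move=> /core_labelsP[u [v [_ uv vx /(label_le uv)/le_trans]]]; apply. Qed.

(** Otherwise the meet of [x] and [y] lies below a lower cover [u] of [x]. The label of this cover
    is a core label of [x], hence of [y], so it lies below the meet and thus below [u], contrary to
    [label_Nle]. *)
Lemma le_core_labels x y : core_labels x \subset core_labels y -> x <= y.
Proof.
move=> /fintype.subsetP xy; apply: contraTT isT => xNy.
have lt1 : x `&` y < x.
  by rewrite lt_neqAle leIl andbT; apply: contraNneq xNy => <-; exact: leIr.
have [u iu ux] := ex_covers_ge lt1.
have [j jl] := ex_label ux.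
have jx : j \in core_labels x by exact: (mem_core_labels (nucleus_le ux) ux (lexx x) jl).
have := label_Nle ux jl; rewrite (le_trans _ iu) // lexI.
by rewrite (core_labels_le jx) (core_labels_le (xy _ jx)).
Qed.

(** A label never lies below the lower end of its cover. A cover above [t] would violate this, as
    all join-irreducibles lie below [t]. So would the label of an atom below a nonzero nucleus,
    since it would also label a cover above the nucleus. *)
Lemma core_labels_eq_JI t : core_labels t = JI L -> nucleus \top = \bot :> L.
Proof.
move=> tE.
have t1 : t = \top.
  apply/eqP; apply: contraTT isT; rewrite -ltx1 => t1.
  have [w _ tw] := ex_covers_le t1; have [j jl] := ex_label tw.
  have /negP[] := label_Nle tw jl; apply: core_labels_le; rewrite tE.
  by case/andP: jl.
rewrite {}t1 in tE.
apply/eqP; apply: contraTT isT; rewrite -lt0x => n0.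
have [a an ca] := ex_covers_le n0.
have [j jl] := ex_label ca.
have : j \in core_labels (\top : L) by rewrite tE; case/andP: jl.
move=> /core_labelsP[u [v [nu uv _ il]]].
have /negP[] := label_Nle uv il.
exact: le_trans (label_le ca jl) (le_trans an nu).
Qed.

Lemma CLO_anti : antisymmetric (CLO L).
Proof. by move=> x y /andP[xy yx]; apply: le_anti; rewrite !le_core_labels. Qed.

Lemma CLO_lattice_iff :
  is_lattice (CLO L) <-> nucleus \top = \bot :> L /\ intersection_property L.
Proof.
split.
  move=> [r a t meets joins]; split.
    (* Joins provide an upper bound of all elements; its core label set contains every singleton
       [core_labels j]. *)
    have top (s : seq L) : exists m, forall x, x \in s -> CLO L x m.
      elim: s => [|x s [m mP]]; first by exists \bot.
      have [p pP] := joins x m; exists p => y.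
      have := r p; rewrite pP => /andP[xp mp].
      by rewrite inE => /predU1P[->//|/mP ym]; exact: t ym mp.
    have [m mP] := top (enum L); apply: (@core_labels_eq_JI m).
    apply/eqP; rewrite finset.eqEsubset core_labels_sub_JI /=.
    apply/fintype.subsetP=> j jJ; have := mP j; rewrite mem_enum => /(_ isT).
    by rewrite /CLO core_labels_ji // finset.sub1set.
  move=> x y; have [m mP] := meets x y; exists m; apply/eqP.
  rewrite finset.eqEsubset finset.subsetI; apply/andP; split; last first.
    by have := mP m; rewrite r.
  (* As [core_labels j] is a singleton, a common core label [j] is a common lower bound of [x] and
     [y]. *)
  apply/fintype.subsetP=> j /finset.setIP[jx jy].
  have jJ : j \in JI L by apply: (fintype.subsetP (core_labels_sub_JI x)).
  by have := mP j; rewrite /CLO core_labels_ji // !finset.sub1set jx jy => ->.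
move=> [n0 ip].
have r : reflexive (CLO L) by move=> x; exact: fintype.subxx.
have t : transitive (CLO L) by move=> x y z; exact: fintype.subset_trans.
have meets x y : exists m, forall z, CLO L z m = CLO L z x && CLO L z y.
  by have [m mE] := ip x y; exists m => z; rewrite /CLO -mE finset.subsetI.
split=> //; first exact: CLO_anti.
move=> x y.
(* Finite meets include the empty one, [\top]; a join is then the meet of all upper bounds. *)
have glb (s : seq L) : exists m, forall z, CLO L z m = all (CLO L z) s.
  elim: s => [|a s [m mP]].
    by exists \top => z; rewrite /CLO core_labels_top_bot // core_labels_sub_JI.
  by have [p pP] := meets a m; exists p => z; rewrite pP mP.
have [m mP] := glb [seq z <- enum L | CLO L x z && CLO L y z].
exists m => z; apply/idP/andP => [mz|[xz yz]]; last first.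
  by have := mP m; rewrite r => /esym/allP; apply; rewrite mem_filter xz yz mem_enum.
split; apply: (t m) mz; rewrite mP; apply/allP=> w; rewrite mem_filter.
  by move=> /andP[/andP[]].
by move=> /andP[/andP[]].
Qed.

End Injective.
End Labels.

(** * A Stokes formula modulo 2 on a cubical grid *)

Section CubicalStokes.
Local Open Scope ring_scope.
Variables (n N : nat).
Local Notation point := {ffun 'I_n -> 'I_N.+1}.
Implicit Types (v w : point) (ks : {set 'I_n}) (s : seq 'I_n) (i j k l : 'I_n).
(** Here [bool] is the field with two elements and each [f i] is a cochain of degree 0 on the
    grid. *)
Variable f : 'I_n -> point -> bool.

(** At [v k = N] the overflow of [inord] resets the coordinate to 0; steps inside a [box] avoid
    this. *)
Definition step k v : point :=
  [ffun j => if j == k then inord (v j).+1 else v j].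

Lemma stepC k l v : step k (step l v) = step l (step k v).
Proof.
apply/ffunP=> j; rewrite !ffunE.
by have [->|jk] := eqVneq j k; have [kl|kl] := eqVneq _ l;
  rewrite ?kl ?eqxx // (negbTE kl).
Qed.

(* The value, modulo 2, of the cup product of the coboundaries of [f i], [i]
   in [s], on the cube with directions [ks] and least vertex [v]. *)
Fixpoint cup s ks v : bool :=
  if s is i :: s' then
    \sum_(k in ks) (f i (step k v) + f i v) * cup s' (ks :\ k) (step k v)
  else 1.

Lemma addbool_eq0 (a : bool) : a + a = 0.
Proof. by case: a. Qed.

(** The pairs [(k, l)] and [(l, k)] contribute equal terms, which cancel modulo 2. *)
Lemma sum_pair_sym ks (F : 'I_n -> 'I_n -> bool) :
  (forall k l, F k l = F l k) ->
  \sum_(k in ks) \sum_(l in ks :\ k) F k l = 0.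
Proof.
move=> FC.
have lt_gt k : k \in ks -> \sum_(l in ks :\ k) F k l =
    \sum_(l in ks | (l < k)%N) F k l + \sum_(l in ks | (k < l)%N) F k l.
  move=> kks; rewrite (bigID (fun l : 'I_n => (l < k)%N)) /=; congr (_ + _).
    apply: eq_bigl => l; rewrite !inE.
    by have [->|] := eqVneq l k; rewrite ?ltnn ?andbF ?andbT.
  apply: eq_bigl => l; rewrite !inE -leqNgt ltn_neqAle.
  have [->|lk] := eqVneq l k; first by rewrite eqxx /= andbF.
  suff -> : k != l :> nat by [].
  by rewrite eq_sym.
rewrite (eq_bigr _ lt_gt) big_split /=.
rewrite (exchange_big_dep (mem ks)) /=; last by move=> k l _ /andP[].
under eq_bigr => l lks.
  under eq_bigr => k _ do rewrite FC.
  rewrite (_ : \big[_/_]_(k in ks | _) _ = \sum_(k in ks | (l < k)%N) F l k).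
    over.
  by apply: eq_bigl => k; rewrite lks.
by rewrite addbool_eq0.
Qed.

Lemma exchange_pair ks (F : 'I_n -> 'I_n -> bool) :
  \sum_(k in ks) \sum_(l in ks :\ k) F k l =
  \sum_(k in ks) \sum_(l in ks :\ k) F l k.
Proof.
rewrite (exchange_big_dep (mem ks)) /=; last by move=> k l _ /finset.setD1P[].
apply: eq_bigr => l lks; apply: eq_bigl => k.
by rewrite !inE lks andbT eq_sym andbC.
Qed.

(* The cup product of coboundaries is a cocycle. *)
Lemma cup_closed s ks v : #|ks| = (size s).+1 ->
  \sum_(k in ks) (cup s (ks :\ k) (step k v) + cup s (ks :\ k) v) = 0.
Proof.
elim: s ks v => [|i s IH] ks v cks /=.
  by rewrite big1.
have cD k : k \in ks -> #|ks :\ k| = (size s).+1.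
  by move=> kks; have := cardsD1 k ks; rewrite kks cks add1n => -[].
have closed k v' : k \in ks -> \sum_(l in ks :\ k) cup s (ks :\ k :\ l) (step l v') =
    \sum_(l in ks :\ k) cup s (ks :\ k :\ l) v'.
  move=> kks; have := IH (ks :\ k) v' (cD k kks); rewrite big_split /=.
  by case: (\sum_(_ in _) _) (\sum_(_ in _) _) => [] [].
have DC k l : ks :\ k :\ l = ks :\ l :\ k by rewrite !finset.setDDl finset.setUC.
(* Expansion into four double sums. The first vanishes by symmetry. The second and third cancel
   after exchanging [k] and [l] in the third and applying [closed] to the second. In the last,
   [closed] makes the terms symmetric. *)
have -> : \sum_(k in ks)
    (\sum_(l in ks :\ k) (f i (step l (step k v)) + f i (step k v)) *
                           cup s (ks :\ k :\ l) (step l (step k v)) +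
     \sum_(l in ks :\ k) (f i (step l v) + f i v) * cup s (ks :\ k :\ l) (step l v)) =
  \sum_(k in ks) \sum_(l in ks :\ k)
     f i (step l (step k v)) * cup s (ks :\ k :\ l) (step l (step k v)) +
  (\sum_(k in ks) \sum_(l in ks :\ k)
     f i (step k v) * (cup s (ks :\ k :\ l) (step l (step k v))) +
  \sum_(k in ks) \sum_(l in ks :\ k) f i (step l v) * cup s (ks :\ k :\ l) (step l v) +
  \sum_(k in ks) \sum_(l in ks :\ k) f i v * cup s (ks :\ k :\ l) (step l v)).
  rewrite -!big_split /=; apply: eq_bigr => k kks.
  by rewrite -!big_split /=; apply: eq_bigr => l lks; rewrite !mulrDl !addrA.
rewrite [X in X + _]sum_pair_sym ?add0r; last first.
  by move=> k l; rewrite stepC DC.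
rewrite [X in _ + X + _]exchange_pair -big_split /= big1 ?add0r; last first.
  move=> k kks; rewrite -big_distrr /= closed // big_distrr -big_split /= big1 //.
  by move=> l lks; rewrite (DC l) addbool_eq0.
under eq_bigr => k kks do rewrite -big_distrr /= closed // big_distrr /=.
by apply: sum_pair_sym => k l; rewrite DC.
Qed.

(** The least vertices of the cubes with directions [ks] in the face where all other coordinates
    equal [N]. *)
Definition box ks v := [forall k, if k \in ks then (v k < N)%N else v k == N :> nat].

(** The sum telescopes in direction [k], leaving the two end faces; [Q] is the box moved by one step
    in that direction. *)
Lemma sum_box_telescope ks k (G : point -> bool) : (0 < N)%N -> k \in ks ->
  \sum_(v | box ks v) (G (step k v) + G v) =
  \sum_(v | box (ks :\ k) v) G v + \sum_(v | box ks v && (v k == 0 :> nat)) G v.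
Proof.
move=> N0 kks.
pose Q v := [forall j, if j \in ks :\ k then (v j < N)%N else
  if j == k then (0 < v j)%N else v j == N :> nat].
pose back v : point := [ffun j => if j == k then inord (v j).-1 else v j].
have lt_box v : box ks v -> (v k < N)%N.
  by move=> /forallP/(_ k); rewrite kks.
have -> : \sum_(v | box ks v) (G (step k v) + G v) =
          \sum_(v | Q v) G v + \sum_(v | box ks v) G v.
  rewrite big_split /=; congr (_ + _).
  rewrite [RHS](reindex_onto (step k) back) /=; last first.
    move=> v /forallP/(_ k); rewrite !inE eqxx /= => v0.
    apply/ffunP=> j; rewrite !ffunE; case: eqP => // ->.
    apply: val_inj => /=.
    have lt1 : ((v k).-1 < N.+1)%N by rewrite (leq_ltn_trans (leq_pred _)).
    by rewrite (inordK lt1) prednK // inord_val.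
  apply: eq_bigl => v; apply/idP/andP => [bv|[/forallP Qv /eqP vE]].
    have vk := lt_box _ bv; split.
      apply/forallP=> j; have := forallP bv j; rewrite !inE !ffunE.
      by have [->|//] := eqVneq j k; rewrite /= inordK.
    apply/eqP/ffunP=> j; rewrite !ffunE; case: eqP => // ->.
    by apply: val_inj; rewrite /= !inordK // (leq_ltn_trans _ (ltn_ord (v k))).
  have vk : (v k < N)%N.
    have /ffunP/(_ k) := vE; rewrite !ffunE eqxx => vkE.
    rewrite ltn_neqAle -ltnS ltn_ord andbT; apply/negP=> /eqP vkN.
    have := Qv k; rewrite !inE !ffunE eqxx /= vkN.
    rewrite /inord val_insubd /= ltnn; case: N {lt_box}=> //.
  apply/forallP=> j; have := Qv j; rewrite !inE !ffunE.
  by have [->|] := eqVneq j k; rewrite ?kks.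
have -> : \sum_(v | box ks v) G v =
  \sum_(v | box ks v && (v k == 0 :> nat)) G v + \sum_(v | box ks v && Q v) G v.
  rewrite (bigID (fun v : point => v k == 0 :> nat)) /=; congr (_ + _).
  apply: eq_bigl => v; case bv: (box ks v) => //=.
  apply/idP/forallP => [v0 j|/(_ k)]; last by rewrite !inE eqxx /= lt0n.
  have := forallP bv j; rewrite !inE.
  by have [->|] := eqVneq j k; rewrite /= ?lt0n.
have -> : \sum_(v | Q v) G v =
  \sum_(v | box (ks :\ k) v && Q v) G v + \sum_(v | box ks v && Q v) G v.
  rewrite (bigID (fun v : point => v k == N :> nat)) /=; congr (_ + _).
    apply: eq_bigl => v; rewrite andbC; case Qv: (Q v); rewrite ?andbF ?andbT //.
    apply/eqP/forallP => [vN j|/(_ k)]; last by rewrite !inE eqxx /= => /eqP.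
    have := forallP Qv j; rewrite !inE.
    by have [->|] := eqVneq j k; rewrite //= vN.
  apply: eq_bigl => v; rewrite andbC; case Qv: (Q v); rewrite ?andbF ?andbT //.
  apply/idP/forallP => [vN j|/(_ k)]; last first.
    by rewrite kks => h; rewrite neq_ltn h.
  have := forallP Qv j; rewrite !inE.
  have [->|] := eqVneq j k => //= _.
  by rewrite kks ltn_neqAle vN -ltnS ltn_ord.
rewrite (eq_bigl (box (ks :\ k))); last first.
  move=> v; case bv: (box (ks :\ k) v) => //=; apply/forallP=> j.
  have := forallP bv j; rewrite !inE.
  by have [->|] := eqVneq j k => //= /eqP->.
by rewrite addrACA addbool_eq0 addr0.
Qed.

Hypothesis N_gt0 : (0 < N)%N.
Hypothesis f_min : forall i v, v i = 0 :> nat -> f i v = false.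
Hypothesis f_max : forall i v, v i = N :> nat -> f i v = true.

Lemma step_neq k j v : j != k -> step k v j = v j.
Proof. by move=> jk; rewrite ffunE (negbTE jk). Qed.

(** The cube lies in a face on which [f k] is constant, so the coboundary of [f k], one of the
    factors, vanishes. *)
Lemma cup_face s ks v k : k \in s -> k \notin ks ->
  v k = 0 :> nat \/ v k = N :> nat -> cup s ks v = false.
Proof.
elim: s ks v => // i s IH ks v; rewrite inE => ks_s kks vk /=.
rewrite big1 // => l lks.
have kl : k != l by apply: contraNneq kks => ->.
have vlk := step_neq v kl.
have [ik|ik] := eqVneq k i.
  rewrite -ik; case: vk => vk; first by rewrite !f_min ?vlk // mul0r.
  by rewrite !f_max ?vlk // mul0r.
rewrite (negbTE ik) /= in ks_s.
by rewrite IH ?mulr0 ?inE ?negb_and ?kks ?orbT ?vlk.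
Qed.

(* As [cup (i :: s)] is the coboundary of [f i] times [cup s], its sum over the
   box is a sum over the faces; only the face [v i = N] contributes, the others
   being killed by [f_min] and [cup_face]. *)
Lemma sum_cup s : uniq s -> \sum_(v | box [set i in s] v) cup s [set i in s] v = true.
Proof.
elim: s => [_|i s IH /= /andP[iNs us]].
  pose v0 : point := [ffun=> ord_max].
  rewrite (big_pred1 v0) // => v; apply/forallP/eqP => [h|-> k]; last first.
    by rewrite !inE ffunE ?in_nil /= ?eqxx.
  by apply/ffunP=> k; have := h k; rewrite !inE ffunE => /eqP h'; apply: val_inj.
set ks := [set j in i :: s].
have ksi : ks :\ i = [set j in s].
  by apply/finset.setP=> j; rewrite !inE; have [->|] := eqVneq j i; rewrite ?(negbTE iNs).
have iks : i \in ks by rewrite !inE eqxx.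
have cks : #|ks| = (size s).+1.
  by rewrite cardsE -[RHS]/(size (i :: s)); apply/card_uniqP; rewrite /= iNs.
pose G k v := f i v * cup s (ks :\ k) v.
(* For each [v] the two inner sums differ by [f i v] times a sum that vanishes by [cup_closed]. *)
have -> : \sum_(v | box ks v) \sum_(k in ks)
    (f i (step k v) + f i v) * cup s (ks :\ k) (step k v) =
  \sum_(v | box ks v) \sum_(k in ks) (G k (step k v) + G k v).
  apply: eq_bigr => v _; rewrite [RHS]big_split /=.
  have := cup_closed v cks; rewrite big_split /= => clo.
  under eq_bigr => k _ do rewrite mulrDl.
  rewrite big_split /=; congr (_ + _); rewrite -!big_distrr /=; congr (_ * _).
  by move: clo; case: (\sum_(_ in _) _) (\sum_(_ in _) _) => [] [].
rewrite exchange_big /=.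
under eq_bigr => k kks do rewrite sum_box_telescope //.
rewrite (bigD1 i) //= [X in _ + X]big1 ?addr0; last first.
  move=> k /andP[kks ki].
  have ks_s : k \in s by move: kks; rewrite !inE (negbTE ki).
  rewrite !big1 // => v.
    by move=> /andP[_ /eqP v0]; rewrite /G (cup_face ks_s) ?mulr0 ?inE ?eqxx //; left.
  move=> /forallP/(_ k); rewrite !inE eqxx /= => /eqP vN.
  by rewrite /G (cup_face ks_s) ?mulr0 ?inE ?eqxx //; right.
rewrite [X in _ + X]big1 ?addr0; last first.
  by move=> v /andP[_ /eqP v0]; rewrite /G f_min ?mul0r.
rewrite ksi -[RHS](IH us); apply: eq_bigr => v.
move=> /forallP/(_ i); rewrite !inE (negbTE iNs) => /eqP vN.
by rewrite /G f_max // mul1r ksi.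
Qed.

(** A nonzero product has a nonzero factor for each [i] in [s], that is, an edge of the cube along
    which [f i] changes. *)
Lemma cup_neq0 s ks v i : (forall k, k \in ks -> (v k < N)%N) ->
  cup s ks v -> i \in s ->
  exists a b, [/\ f i a, ~~ f i b &
    forall k, (v k <= a k <= (v k).+1)%N && (v k <= b k <= (v k).+1)%N].
Proof.
(* The induction confines the vertices to the directions [ks], because the recursion moves on to the
   face with directions [ks :\ k] at [step k v]. *)
move=> vN; suff : cup s ks v -> i \in s -> exists a b, [/\ f i a, ~~ f i b &
  forall k, (v k <= a k <= v k + (k \in ks))%N && (v k <= b k <= v k + (k \in ks))%N].
  move=> h cs is_; have [a [b [fa fb ab]]] := h cs is_; exists a, b; split=> // k.
  have /andP[/andP[-> ak] /andP[-> bk]] := ab k.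
  have le1 : (v k + (k \in ks) <= (v k).+1)%N by case: (_ \in _); rewrite ?addn1 ?addn0.
  by rewrite !(leq_trans _ le1).
elim: s ks v vN => // j s IH ks v vN /= cs.
have [k kks ck] : exists2 k, k \in ks &
    (f j (step k v) + f j v) * cup s (ks :\ k) (step k v).
  apply/exists_inP; apply: contraTT isT => /exists_inPn h.
  by move: cs; rewrite big1 // => k /h/negbTE.
have /andP[fj cs'] := ck.
have vkN := vN _ kks.
have sk l : step k v l = (v l + (l == k))%N :> nat.
  by rewrite ffunE; have [->|_] := eqVneq l k; rewrite ?addn0 ?addn1 ?inordK.
rewrite inE => /predU1P[ij|is_].
  rewrite {}ij.
  exists (if f j v then v else step k v), (if f j v then step k v else v).
  have [fa fb] : f j (if f j v then v else step k v) /\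
                 ~~ f j (if f j v then step k v else v).
    by move: fj; case fv: (f j v); case fs: (f j (step k v)); rewrite ?fv ?fs.
  split=> // l.
  have le1 : (v l <= v l + (l \in ks))%N by rewrite leq_addr.
  have le2 : (v l <= step k v l <= v l + (l \in ks))%N.
    rewrite sk leq_addr leq_add2l.
    by have [->|] := eqVneq l k; rewrite ?kks.
  by case: ifP; rewrite le2 leqnn le1.
have [|a [b [fa fb ab]]] := IH (ks :\ k) (step k v) _ cs' is_.
  by move=> l /finset.setD1P[lk lks]; rewrite step_neq // vN.
exists a, b; split=> // l; have /andP[/andP[a1 a2] /andP[b1 b2]] := ab l.
have le1 : (v l <= step k v l)%N by rewrite sk leq_addr.
have le2 : (step k v l + (l \in ks :\ k) <= v l + (l \in ks))%N.
  rewrite sk -addnA leq_add2l !inE.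
  by have [->|] := eqVneq l k; rewrite ?kks.
by rewrite (leq_trans le1 a1) (leq_trans le1 b1) (leq_trans a2 le2) (leq_trans b2 le2).
Qed.

(** Some term of the nonzero sum in [sum_cup] is nonzero. This is a combinatorial form of the
    Poincare-Miranda theorem. *)
Lemma ex_full_cell : exists v, (forall k, (v k < N)%N) /\
  forall i, exists a b, [/\ f i a, ~~ f i b &
    forall k, (v k <= a k <= (v k).+1)%N && (v k <= b k <= (v k).+1)%N].
Proof.
have := sum_cup (enum_uniq 'I_n); set ks := [set i in _] => h.
have [v bv cv] : exists2 v, box ks v & cup (enum 'I_n) ks v.
  apply/exists_inP; apply: contraTT isT => /exists_inPn h'.
  by move: h; rewrite big1 // => v /h'/negbTE.
have vN k : (v k < N)%N by have /forallP/(_ k) := bv; rewrite inE mem_enum.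
by exists v; split=> // i; apply: cup_neq0 cv _; rewrite ?mem_enum.
Qed.

End CubicalStokes.

(** * Homotopies of order complexes *)

Section RealLimits.
Local Open Scope classical_set_scope.
Local Open Scope ring_scope.
Context {R : realType} {T : Type} {F : set_system T} {FF : Filter F}.

Lemma cvg_sumr (I : Type) (r : seq I) (P : pred I) (f : I -> T -> R) (a : I -> R) :
  (forall i, P i -> f i x @[x --> F] --> a i) ->
  (\sum_(i <- r | P i) f i x) @[x --> F] --> \sum_(i <- r | P i) a i.
Proof. by apply: cvg_big; exact: add_continuous. Qed.

Lemma cvg_prodr (I : Type) (r : seq I) (P : pred I) (f : I -> T -> R) (a : I -> R) :
  (forall i, P i -> f i x @[x --> F] --> a i) ->
  (\prod_(i <- r | P i) f i x) @[x --> F] --> \prod_(i <- r | P i) a i.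
Proof. by apply: cvg_big; exact: mul_continuous. Qed.

Lemma cvg_maxr (f g : T -> R) (a b : R) :
  f x @[x --> F] --> a -> g x @[x --> F] --> b ->
  Num.max (f x) (g x) @[x --> F] --> Num.max a b.
Proof.
by move=> fa gb; apply: continuous2_cvg fa gb; exact: (@max_continuous _ R (a, b)).
Qed.

Lemma cvg_minr (f g : T -> R) (a b : R) :
  f x @[x --> F] --> a -> g x @[x --> F] --> b ->
  Num.min (f x) (g x) @[x --> F] --> Num.min a b.
Proof.
by move=> fa gb; apply: continuous2_cvg fa gb; exact: (@min_continuous _ R (a, b)).
Qed.

Lemma cvg_coord n (f : T -> 'rV[R]_n) (a : 'rV[R]_n) i :
  f x @[x --> F] --> a -> (f x 0 i) @[x --> F] --> a 0 i.
Proof.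
move=> fa; apply: (cvg_comp f (fun M : 'rV[R]_n => M 0 i) fa).
exact: coord_continuous.
Qed.

Lemma cvg_rV n (f : T -> 'rV[R]_n) (a : 'rV[R]_n) :
  (forall i, (f x 0 i) @[x --> F] --> a 0 i) -> f x @[x --> F] --> a.
Proof.
move=> fa; apply/cvg_ballP => e e0.
have h i : \forall x \near F, ball (a 0 i) e (f x 0 i).
  by move/cvg_ballP: (fa i); apply.
have := filter_forall FF h; apply: filterS => x hx; split=> // i j.
by rewrite ord1.
Qed.

Lemma cvg_to_within (X : topologicalType) (f : T -> X) (a : X) (A : set X) :
  f x @[x --> F] --> a -> (\forall x \near F, A (f x)) ->
  f x @[x --> F] --> within A (nbhs a).
Proof.
move=> fa FA P PA; have := fa _ PA; rewrite /= !nbhs_simpl /= => h.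
by apply: filterS2 FA h => x Ax; apply.
Qed.

Lemma near_within (X : topologicalType) (A : set X) (a : X) :
  \forall x \near within A (nbhs a), A x.
Proof. exact: withinT. Qed.

End RealLimits.

Section WithinProd.
Local Open Scope classical_set_scope.
Context {X Y : topologicalType} (A : set (X * Y)) (x : X) (y : Y).

Lemma cvg_fst_within : z.1 @[z --> within A (nbhs (x, y))] --> x.
Proof.
apply: cvg_trans (@cvg_fst _ _ (nbhs x) (nbhs y) _).
by apply: cvg_app; exact: cvg_within.
Qed.

Lemma cvg_snd_within : z.2 @[z --> within A (nbhs (x, y))] --> y.
Proof.
apply: cvg_trans (@cvg_snd _ _ (nbhs x) (nbhs y) _).
by apply: cvg_app; exact: cvg_within.
Qed.

End WithinProd.

Section Homotopy.
Local Open Scope classical_set_scope.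
Local Open Scope ring_scope.
Variables (R : realType).

Lemma homotopicI (X Y : topologicalType) (A : set X) (B : set Y)
    (f g : X -> Y) (h : R * X -> Y) :
  (forall (s : R) x, 0 <= s <= 1 -> A x ->
     h z @[z --> within (`[0, 1]%classic `*` A) (nbhs (s, x))] --> h (s, x)) ->
  (forall (s : R) x, 0 <= s <= 1 -> A x -> B (h (s, x))) ->
  (forall x, A x -> h (0, x) = f x) -> (forall x, A x -> h (1, x) = g x) ->
  homotopic R A B f g.
Proof.
move=> hc hB h0 h1; exists h; split=> //.
  apply/subspace_continuousP => -[s x] [/= s01 Ax]; apply: hc => //.
Qed.

End Homotopy.

(** * Mass on chains and closure operators *)

Section Realization.
Local Open Scope ring_scope.
Context {d : Order.disp_t} (L : finTBLatticeType d) (R : realType).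
Implicit Types (x y z : L) (v : 'rV[R]_#|L|) (w : L -> R) (S : {set L}).

Definition weight v x : R := v 0 (enum_rank x).
Definition of_weight w : 'rV[R]_#|L| := \row_i w (enum_val i).

Lemma weightK w x : weight (of_weight w) x = w x.
Proof. by rewrite /weight mxE enum_rankK. Qed.

Lemma of_weightK v : of_weight (weight v) = v.
Proof. by apply/rowP=> i; rewrite mxE /weight enum_valK. Qed.

Lemma order_complexP S : reflect
  [/\ forall x, x \in S -> x != \bot%O /\ x != \top%O &
      forall x y, x \in S -> y \in S -> (x >=< y)%O]
  (S \in order_complex L).
Proof.
rewrite inE; apply: (iffP and3P) => [[b t /forall_inP c]|[pr c]]; split.
- by move=> x xS; split; [apply: contraNneq b => <-|apply: contraNneq t => <-].
- by move=> x y xS yS; have /forall_inP := c x xS; apply.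
- by apply/negP => /pr[]; rewrite eqxx.
- by apply/negP => /pr[_]; rewrite eqxx.
- by apply/forall_inP=> x xS; apply/forall_inP=> y yS; exact: c.
Qed.

Lemma order_complex_sub S S' :
  S \subset S' -> S' \in order_complex L -> S \in order_complex L.
Proof.
move=> /fintype.subsetP SS' /order_complexP[pr c]; apply/order_complexP; split.
  by move=> x /SS'/pr.
by move=> x y /SS' xS /SS' yS; exact: c.
Qed.

Definition supp_set w : {set L} := [set x | w x != 0]%SET.

Definition barycentric w : Prop :=
  [/\ forall x, 0 <= w x, \sum_x w x = 1 & supp_set w \in order_complex L].

Lemma barycentric_neq0 w : barycentric w -> exists x, x \in supp_set w.
Proof.
move=> [_ w1 _]; apply/existsP; apply: contraT => /existsPn h; move/eqP: w1.
rewrite big1 ?(eq_sym 0) ?oner_eq0 // => x _.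
by have := h x; rewrite inE negbK => /eqP.
Qed.

Lemma realizationP v :
  realization (order_complex L) v <-> barycentric (weight v).
Proof.
have sE : \sum_i v 0 i = \sum_x weight v x.
  rewrite (reindex (@enum_rank L)) //=.
  by apply: onW_bij; exact: enum_rank_bij.
split=> -[v0 v1 vK]; split=> //; rewrite ?sE // -?sE //; first by move=> x; exact: v0.
by move=> i; have := v0 (enum_val i); rewrite /weight enum_valK.
Qed.

Lemma realization_of_weight w :
  realization (order_complex L) (of_weight w) <-> barycentric w.
Proof.
rewrite realizationP; suff -> : weight (of_weight w) = w by [].
by apply: funext => x; exact: weightK.
Qed.

Lemma ler_sum_pred (P Q : pred L) w : (forall x, 0 <= w x) ->
  {subset P <= Q} -> \sum_(x | P x) w x <= \sum_(x | Q x) w x.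
Proof.
move=> w0 PQ; rewrite [X in _ <= X](bigID P) /=.
rewrite [X in _ <= X + _](eq_bigl P) ?lerDl ?sumr_ge0 // => x.
by apply/andP/idP => [[]//|Px]; split=> //; exact: PQ.
Qed.

Section Closure.
Variable cl : L -> L.

(** With the masses stacked along the chain from bottom to top, this is the part of the mass at [x]
    within height [r]. *)
Definition kept (r : R) w x : R :=
  Num.min (w x) (Num.max 0 (r - \sum_(y | (y < x)%O) w y)).

(* The bottom mass [r] of [w] stays in place, the rest is pushed along [cl];
   as [cl] is increasing the result is again carried by a chain. *)
Definition push r w z : R :=
  kept r w z + \sum_(x | cl x == z) (w x - kept r w x).

Lemma kept_ge0 r w x : (forall x, 0 <= w x) -> 0 <= kept r w x.
Proof. by move=> w0; rewrite /kept le_min w0 le_max lexx. Qed.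

Lemma kept_le r w x : kept r w x <= w x.
Proof. by rewrite /kept ge_min lexx. Qed.

Lemma push_ge0 r w z : (forall x, 0 <= w x) -> 0 <= push r w z.
Proof.
move=> w0; rewrite addr_ge0 ?kept_ge0 // sumr_ge0 // => x _.
by rewrite subr_ge0 kept_le.
Qed.

Lemma sum_push r w : \sum_z push r w z = \sum_x w x.
Proof.
rewrite big_split /= -(_ : \sum_x (w x - kept r w x) = \sum_z \sum_(x | cl x == z) _).
  rewrite -big_split /=.
  by apply: eq_bigr => x _; rewrite addrC subrK.
by rewrite (partition_big cl xpredT).
Qed.

Lemma kept1 w : barycentric w -> kept 1 w =1 w.
Proof.
move=> [w0 w1 _] x; rewrite /kept; apply/min_idPl.
rewrite le_max; apply/orP; right.
rewrite lerBrDr -w1 [X in _ <= X](bigD1 x) //= lerD2l.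
by apply: ler_sum_pred => // y; rewrite !unfold_in => /lt_eqF->.
Qed.

Lemma push1 w : barycentric w -> push 1 w =1 w.
Proof.
move=> bw z; rewrite /push kept1 // big1 ?addr0 // => x _.
by rewrite kept1 // subrr.
Qed.

Lemma kept0 w x : (forall x, 0 <= w x) -> kept 0 w x = 0.
Proof.
move=> w0; rewrite /kept (max_idPl _); first by apply/min_idPr.
by rewrite sub0r oppr_le0 sumr_ge0.
Qed.

Lemma push0 w z : (forall x, 0 <= w x) -> push 0 w z = \sum_(x | cl x == z) w x.
Proof.
move=> w0; rewrite /push kept0 // add0r; apply: eq_bigr => x _.
by rewrite kept0 // subr0.
Qed.

Lemma sum_neq0 (P : pred L) w : \sum_(x | P x) w x != 0 ->
  exists2 x, P x & w x != 0.
Proof.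
move=> h; apply/exists_inP; apply: contraNT h => /exists_inPn h.
by rewrite big1 // => x /h; rewrite negbK => /eqP.
Qed.

Hypothesis cl_proper : forall x, x != \bot%O -> x != \top%O ->
  cl x != \bot%O /\ cl x != \top%O.
Hypothesis cl_mono : forall x y, (x <= y)%O -> (cl x <= cl y)%O.
Hypothesis cl_ge : forall x, (x <= cl x)%O.

Lemma support_push0 w : (forall x, 0 <= w x) ->
  supp_set (push 0 w) \subset [set cl x | x in supp_set w]%SET.
Proof.
move=> w0; apply/fintype.subsetP => z; rewrite inE push0 // => /sum_neq0[x /eqP<- wx].
by apply: imset_f; rewrite inE.
Qed.

Lemma barycentric_push r w : barycentric w -> barycentric (push r w).
Proof.
move=> bw; have [w0 w1 /order_complexP[wp wc]] := bw; split.
- by move=> z; exact: push_ge0.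
- by rewrite sum_push.
have kw x : kept r w x != 0 -> x \in supp_set w.
  rewrite inE; apply: contraNneq => wx.
  by have := kept_le r w x; rewrite wx => kx; rewrite eq_le kx kept_ge0.
have mw x : w x - kept r w x != 0 -> x \in supp_set w.
  rewrite inE; apply: contraNneq => wx.
  have := kept_le r w x; rewrite wx => kx.
  by rewrite sub0r oppr_eq0 eq_le kx kept_ge0.
(* Elements keeping mass lie below those losing mass: if [y < x] and [x] keeps some, then [r]
   exceeds the mass strictly below [x], so [y] keeps all of its own. *)
have mk x y : kept r w x != 0 -> w y - kept r w y != 0 -> (x <= y)%O.
  move=> kx my; have := wc x y (kw x kx) (mw y my).
  rewrite /Order.comparable => /orP[//|]; rewrite le_eqVlt => /predU1P[->//|yx].
  case/negP: my; rewrite subr_eq0 eq_sym; apply/eqP/min_idPl.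
  have kx0 : 0 < kept r w x by rewrite lt_def kx kept_ge0.
  have : 0 < r - \sum_(z | (z < x)%O) w z.
    by move: kx0; rewrite lt_min lt_max ltxx /= => /andP[].
  rewrite subr_gt0 => h; rewrite le_max; apply/orP; right.
  rewrite lerBrDr; apply: le_trans (ltW h).
  rewrite [X in _ <= X](bigD1 y) //= lerD2l.
  apply: ler_sum_pred => // z; rewrite !unfold_in => zy.
  by rewrite (lt_trans zy yx) (lt_eqF zy).
have sp z : z \in supp_set (push r w) -> kept r w z != 0 \/
    exists2 x, cl x = z & w x - kept r w x != 0.
  rewrite inE /push; have [->|kz] := eqVneq (kept r w z) 0; last by left.
  by rewrite add0r => /sum_neq0[x /eqP xz wx]; right; exists x.
apply/order_complexP; split.
  move=> z /sp[/kw/wp//|[x <- /mw/wp[]]].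
  exact: cl_proper.
move=> y z /sp[ky|[y' <- my]] /sp[kz|[z' <- mz]].
- exact: wc (kw _ ky) (kw _ kz).
- by rewrite /Order.comparable (le_trans (mk _ _ ky mz)) ?cl_ge.
- by rewrite /Order.comparable (le_trans (mk _ _ kz my)) ?cl_ge ?orbT.
- by have := wc _ _ (mw _ my) (mw _ mz); rewrite /Order.comparable => /orP[] /cl_mono->;
    rewrite ?orbT.
Qed.

Lemma cvg_kept {T : Type} {F : set_system T} {FF : Filter F}
    (r : T -> R) (w : T -> L -> R) (r0 : R) (w0 : L -> R) x :
  (r t @[t --> F] --> r0)%classic -> (forall y, w t y @[t --> F] --> w0 y)%classic ->
  (kept (r t) (w t) x @[t --> F] --> kept r0 w0 x)%classic.
Proof.
move=> hr hw; apply: cvg_minr => //; apply: cvg_maxr; first exact: cvg_cst.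
by apply: cvgB => //; apply: cvg_sumr.
Qed.

Lemma cvg_push {T : Type} {F : set_system T} {FF : Filter F}
    (r : T -> R) (w : T -> L -> R) (r0 : R) (w0 : L -> R) x :
  (r t @[t --> F] --> r0)%classic -> (forall y, w t y @[t --> F] --> w0 y)%classic ->
  (push (r t) (w t) x @[t --> F] --> push r0 w0 x)%classic.
Proof.
move=> hr hw; apply: cvgD; first exact: cvg_kept.
by apply: cvg_sumr => y _; apply: cvgB => //; exact: cvg_kept.
Qed.

Lemma barycentric_convex (a b : L -> R) (l : R) : 0 <= l <= 1 ->
  barycentric a -> barycentric b -> supp_set a :|: supp_set b \in order_complex L ->
  barycentric (fun x => a x + l * (b x - a x)).
Proof.
move=> /andP[l0 l1] [a0 a1 _] [b0 b1 _] ab; split.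
- move=> x; rewrite (_ : _ + _ = (1 - l) * a x + l * b x).
    by rewrite addr_ge0 // mulr_ge0 // subr_ge0.
  by rewrite mulrBr mulrBl mul1r addrCA addrC.
- by rewrite big_split /= -big_distrr /= sumrB a1 b1 subrr mulr0 addr0.
- apply: order_complex_sub ab; apply/fintype.subsetP=> x; rewrite !inE.
  apply: contraNT; rewrite negb_or !negbK => /andP[/eqP-> /eqP->].
  by rewrite subrr mulr0 addr0.
Qed.

Local Notation K := (@realization R L (order_complex L)).

(** The homotopy has two stages: a segment from [q v] to the image of [v] under [cl], inside a
    simplex by the last hypothesis, then [push] with [r] growing from 0 to 1, which ends at [v]. *)
Lemma closure_homotopic (q : 'rV[R]_#|L| -> 'rV[R]_#|L|) :
  (forall v, K v -> q x @[x --> within K (nbhs v)] --> q v)%classic ->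
  (forall v, K v -> K (q v)) ->
  (forall v, K v -> [set cl x | x in supp_set (weight v)]%SET :|:
     supp_set (weight (q v)) \in order_complex L) ->
  homotopic R K K q id.
Proof.
move=> qc qK qS.
(* [r] vanishes on the first half of the interval and [l] on the second, so one continuous formula
   covers both stages. *)
pose r (s : R) : R := Num.max 0 (2 * s - 1).
pose l (s : R) : R := Num.max 0 (1 - 2 * s).
pose h (z : R * 'rV[R]_#|L|) := of_weight (fun x =>
  push (r z.1) (weight z.2) x +
  l z.1 * (weight (q z.2) x - push 0 (weight z.2) x)).
apply: (homotopicI (h := h)).
- move=> s v s01 Kv; set F := within _ _.
  have c1 : (z.1 @[z --> F] --> s)%classic by exact: cvg_fst_within.
  have c2 : (z.2 @[z --> F] --> v)%classic by exact: cvg_snd_within.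
  have cq : (q z.2 @[z --> F] --> q v)%classic.
    apply: (cvg_comp (fun z : R * 'rV[R]_#|L| => z.2) q _ (qc v Kv)).
    apply: cvg_to_within c2 _.
    by apply: filterS (near_within _ _) => z [].
  have cw y : (weight z.2 y @[z --> F] --> weight v y)%classic by exact: cvg_coord.
  apply: cvg_rV => i; rewrite mxE.
  under eq_cvg do rewrite mxE.
  apply: cvgD; first apply: cvg_push => //.
    apply: cvg_maxr; first exact: cvg_cst.
    by apply: cvgB; [apply: cvgM => //; exact: cvg_cst|exact: cvg_cst].
  apply: cvgM.
    apply: cvg_maxr; first exact: cvg_cst.
    by apply: cvgB; [exact: cvg_cst|apply: cvgM => //; exact: cvg_cst].
  apply: cvgB; first exact: cvg_coord.
  by apply: cvg_push => //; exact: cvg_cst.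
- move=> s v /andP[s0 s1] Kv; apply/realization_of_weight => /=.
  have bv : barycentric (weight v) by apply/realizationP.
  have bq : barycentric (weight (q v)) by apply/realizationP/qK.
  have [s2|s2] := leP (2 * s) 1.
    have -> : r s = 0 by apply/max_idPl; rewrite subr_le0.
    apply: barycentric_convex => //.
    + by rewrite le_max lexx /= ge_max ler01 lerBlDr lerDl mulr_ge0.
    + exact: barycentric_push.
    + apply: order_complex_sub (qS v Kv); apply: finset.setSU.
      by apply: support_push0; case: bv.
  have -> : l s = 0 by apply/max_idPl; rewrite subr_le0 ltW.
  rewrite (_ : (fun x => _) = push (r s) (weight v)); first exact: barycentric_push.
  by apply: funext => x; rewrite mul0r addr0.
- move=> v Kv; rewrite /h /= -[RHS]of_weightK; congr of_weight; apply: funext => x.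
  have -> : r 0 = 0 by apply/max_idPl; rewrite mulr0 sub0r lerN10.
  have -> : l 0 = 1 by rewrite /l mulr0 subr0; apply/max_idPr.
  by rewrite mul1r addrC subrK.
- move=> v Kv; rewrite /h /= -[RHS]of_weightK; congr of_weight; apply: funext => x.
  have -> : l 1 = 0 by apply/max_idPl; rewrite mulr1 subr_le0 ler1n.
  have -> : r 1 = 1.
    by rewrite /r mulr1 (_ : 2 - 1 = 1 :> R) ?(max_idPr _) // -[X in X - _]natr1 addrK.
  by rewrite mul0r addr0 push1 //; apply/realizationP.
Qed.

End Closure.
End Realization.

(** * Spheres are not contractible *)

Section PoincareMiranda.
Local Open Scope classical_set_scope.
Local Open Scope ring_scope.
Variables (R : realType) (n : nat) (F : 'rV[R]_n -> 'rV[R]_n).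
Implicit Types (x a p q : 'rV[R]_n).

Definition in_cube x := forall j, -1 <= x 0 j <= 1.

Hypothesis F_min : forall x i, in_cube x -> x 0 i = -1 -> F x 0 i <= 0.
Hypothesis F_max : forall x i, in_cube x -> x 0 i = 1 -> 0 <= F x 0 i.

Lemma miranda_cell (m : nat) : exists a, in_cube a /\ forall i, exists p q,
  [/\ 0 <= F p 0 i, F q 0 i <= 0, forall j, `|a 0 j - p 0 j| <= 2 / m.+1%:R &
      forall j, `|a 0 j - q 0 j| <= 2 / m.+1%:R].
Proof.
pose N := m.+1.
have N0 : 0 < N%:R :> R by rewrite ltr0n.
pose pt (v : {ffun 'I_n -> 'I_N.+1}) : 'rV[R]_n := \row_j (2 / N%:R * (v j)%:R - 1).
have pt_cube v : in_cube (pt v).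
  move=> j; rewrite mxE lerBrDr addNr lerBlDr.
  rewrite mulr_ge0 ?divr_ge0 ?ler0n //= mulrAC ler_pdivrMr // -[1 + 1]/(2%:R).
  by rewrite ler_pM2l ?ltr0n // ler_nat -ltnS ltn_ord.
(* The sign of [F], overridden on the two extreme faces to meet the boundary conditions of the grid;
   there [F_min] and [F_max] still give the weak signs. *)
pose f i (v : {ffun 'I_n -> 'I_N.+1}) :=
  (v i == N :> nat) || ((v i != 0%N :> nat) && (0 < F (pt v) 0 i)).
have [|||v [vN fv]] := @ex_full_cell n N f.
- by [].
- by move=> i v v0; rewrite /f v0.
- by move=> i v v0; rewrite /f v0 eqxx.
exists (pt v); split=> // i; have [a [b [fa fb ab]]] := fv i.
have close (c : {ffun 'I_n -> 'I_N.+1}) : (forall k, (v k <= c k <= (v k).+1)%N) ->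
    forall j, `|pt v 0 j - pt c 0 j| <= 2 / N%:R.
  move=> cv j; have /andP[c1 c2] := cv j.
  rewrite !mxE opprB addrA subrK -mulrBr normrM ger0_norm ?divr_ge0 ?ler0n //.
  rewrite ger_pMr ?divr_gt0 ?ltr0n // distrC ger0_norm ?subr_ge0 ?ler_nat //.
  by rewrite lerBlDr -[1]/(1%:R) -natrD ler_nat add1n.
exists (pt a), (pt b); split.
- move: fa; rewrite /f => /orP[/eqP aN|/andP[_ /ltW//]].
  by apply: F_max => //; rewrite mxE aN divfK ?gt_eqF // -natr1 addrK.
- move: fb; rewrite /f negb_or negb_and negbK => /andP[_ /orP[/eqP b0|]].
    by apply: F_min => //; rewrite mxE b0 mulr0 sub0r.
  by rewrite -leNgt.
- by apply: close => k; have /andP[] := ab k.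
- by apply: close => k; have /andP[_] := ab k.
Qed.

(** At a cluster point of ever smaller cells no coordinate of [F] can be nonzero: by continuity it
    would keep its strict sign nearby, while each cell has close points of both weak signs. *)
Theorem poincare_miranda : continuous F -> exists x, F x = 0.
Proof.
move=> Fc; have /choice[a aP] := miranda_cell.
have acube : (a @ \oo) [set x | forall i, `[-1, 1]%classic (x ord0 i)].
  exists 0%N => // m _ i /=; rewrite in_itv /=.
  by have [/(_ i)] := aP m.
have [x [_ xa]] := @rV_compact R n (fun=> `[-1, 1]%classic)
  (fun=> segment_compact (a := -1) (b := 1)) (a @ \oo) _ acube.
exists x; apply/rowP=> i; rewrite mxE; apply/eqP; apply: contraT => Fxi.
have : \forall y \near x, 0 < F y 0 i * F x 0 i.
  have : (F y 0 i * F x 0 i) @[y --> x] --> F x 0 i * F x 0 i.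
    have c1 : F y 0 i @[y --> x] --> F x 0 i by apply: cvg_coord; exact: Fc.
    by apply: (cvgM c1); exact: cvg_cst.
  have F2 : 0 < F x 0 i * F x 0 i by rewrite -expr2 exprn_even_gt0.
  by move=> /cvgr_gt/(_ _ F2).
move=> /nbhs_ballP[e /= e0 eP].
(* From index [M] on, the points of both signs are within [e / 2] of [a k], which itself comes
   within [e / 2] of [x]. *)
pose M := Num.truncn (4 / e).
have Me k : (M <= k)%N -> 2 / k.+1%:R < e / 2.
  move=> Mk; rewrite ltr_pdivrMr ?ltr0n // mulrAC ltr_pdivlMr // -natrM.
  rewrite mulrC -ltr_pdivrMr //; apply: lt_le_trans (truncnS_gt _) _.
  by rewrite ler_nat ltnS.
have [y [[k Mk ky] [_ xy]]] : (a @` [set k | (M <= k)%N] `&` ball x (e / 2)) !=set0.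
  apply: xa; last by apply: nbhsx_ballx; rewrite divr_gt0.
  by exists M => // k /= Mk; exists k.
have [_ /(_ i)[p [q [Fp Fq ap aq]]]] := aP k.
have close (c : 'rV[R]_n) : (forall j, `|a k 0 j - c 0 j| <= 2 / k.+1%:R) -> ball x e c.
  move=> ac; split=> // i' j; rewrite ord1.
  have := xy 0 j; rewrite -ky /ball /= => xaj.
  rewrite (splitr e); apply: le_lt_trans (ltrD xaj (le_lt_trans (ac j) (Me k Mk))).
  by rewrite -[X in `|X|](subrKA (a k 0 j)) ler_normD.
have := eP _ (close _ ap); have := eP _ (close _ aq) => /=.
have [F0|F0] := ltP 0 (F x 0 i).
  by rewrite pmulr_lgt0 // => /lt_geF; rewrite Fq.
have {}F0 : F x 0 i < 0 by rewrite lt_neqAle Fxi.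
by rewrite !nmulr_lgt0 // => _ /lt_geF; rewrite Fp.
Qed.

End PoincareMiranda.

(** * Euclidean spheres *)

Section Sphere.
Local Open Scope classical_set_scope.
Local Open Scope ring_scope.
Variables (R : realType) (n : nat).
Implicit Types (x u : 'rV[R]_n).
Local Notation S := (@sphere R n).

Definition enorm x : R := Num.sqrt (\sum_(i < n) x 0 i ^+ 2).
Definition normalize x : 'rV[R]_n := (enorm x)^-1 *: x.

Lemma enorm_ge0 x : 0 <= enorm x.
Proof. exact: sqrtr_ge0. Qed.

Lemma sqr_enorm x : enorm x ^+ 2 = \sum_(i < n) x 0 i ^+ 2.
Proof. by rewrite sqr_sqrtr // sumr_ge0 // => i _; rewrite sqr_ge0. Qed.

Lemma enorm_gt0 x i : x 0 i != 0 -> 0 < enorm x.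
Proof.
move=> xi; rewrite sqrtr_gt0 (bigD1 i) //= ltr_wpDr ?exprn_even_gt0 //.
by rewrite sumr_ge0 // => j _; rewrite sqr_ge0.
Qed.

Lemma ler_coord_enorm x i : `|x 0 i| <= enorm x.
Proof.
rewrite -sqrtr_sqr ler_sqrt; last by rewrite sumr_ge0 // => j _; rewrite sqr_ge0.
rewrite (bigD1 i) //= lerDl sumr_ge0 // => j _; exact: sqr_ge0.
Qed.

Lemma sphere_normalize x : 0 < enorm x -> S (normalize x).
Proof.
move=> x0; rewrite /sphere /=.
under eq_bigr => i _ do rewrite mxE exprMn.
by rewrite -big_distrr /= -sqr_enorm -exprMn mulVf ?expr1n // gt_eqF.
Qed.

Lemma sphere_enorm u : S u -> enorm u = 1.
Proof. by rewrite /sphere /= /enorm => ->; rewrite sqrtr1. Qed.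

Lemma normalize_sphere u : S u -> normalize u = u.
Proof. by move=> Su; rewrite /normalize sphere_enorm // invr1 scale1r. Qed.

Lemma sphere_neq0 u : S u -> exists i, u 0 i != 0.
Proof.
move=> Su; apply/existsP; apply: contraT => /existsPn h.
have : enorm u = 0.
  by rewrite /enorm big1 ?sqrtr0 // => i _; move/negPn/eqP: (h i) => ->; rewrite expr0n.
by rewrite sphere_enorm // => /eqP; rewrite oner_eq0.
Qed.

Section Cvg.
Context {T : Type} {F : set_system T} {FF : Filter F}.
Variables (f : T -> 'rV[R]_n) (a : 'rV[R]_n).
Hypothesis fa : forall i, f t 0 i @[t --> F] --> a 0 i.

Lemma cvg_enorm : enorm (f t) @[t --> F] --> enorm a.
Proof.
have c2 i : f t 0 i ^+ 2 @[t --> F] --> a 0 i ^+ 2.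
  exact: (cvgM (@fa i) (@fa i)).
have c : (\sum_(i < n) f t 0 i ^+ 2) @[t --> F] --> \sum_(i < n) a 0 i ^+ 2.
  exact: cvg_sumr.
exact: (cvg_comp _ _ c (@sqrt_continuous R _)).
Qed.

Lemma cvg_normalize : 0 < enorm a -> normalize (f t) @[t --> F] --> normalize a.
Proof.
move=> a0; apply: cvg_rV => i; rewrite mxE; under eq_cvg do rewrite mxE.
by apply: cvgM => //; apply: cvgV; [rewrite gt_eqF|exact: cvg_enorm].
Qed.

End Cvg.

(** A contraction yields a continuous map from the whole space to the sphere that is radial on the
    boundary of the cube. By [poincare_miranda] it has a zero, which is not on the sphere. *)
Lemma sphere_not_contractible p : S p -> ~ homotopic R S S (fun=> p) id.
Proof.
move=> Sp [h [/subspace_continuousP hc hS h0 h1]].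
(* Constant on the ball of radius 1/2; beyond it the radius serves as time, and the homotopy is
   finished at radius 1, hence on the whole boundary of the cube. *)
pose F x := if 2 * enorm x <= 1 then p
            else h (Num.min 1 (2 * enorm x - 1), normalize x).
have FS x : S (F x).
  rewrite /F; case: leP => // x1; apply: hS.
    by rewrite /= in_itv /= le_min ler01 subr_ge0 ltW //= ge_min lexx.
  apply: sphere_normalize.
  by rewrite -(pmulr_rgt0 _ (ltr0n R 2)) (lt_trans ltr01).
have Fc (x : 'rV[R]_n) : F y @[y --> x] --> F x.
  have FFx : Filter (nbhs x) := nbhs_filter x.
  have ce : enorm y @[y --> x] --> enorm x.
    by apply: (@cvg_enorm _ (nbhs x) FFx id x) => i; exact: coord_continuous.
  have ce2 : 2 * enorm y @[y --> x] --> 2 * enorm x by apply: (cvgM _ ce); exact: cvg_cst.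
  have [x1|x1] := ltP (2 * enorm x) 1.
    have -> : F x = p by rewrite /F (ltW x1).
    apply: cvg_near_cst; near=> y; rewrite /F ifT //; apply: ltW.
    by near: y; exact: (cvgr_lt _ ce2 _ x1).
  have x0 : 0 < enorm x.
    by rewrite -(pmulr_rgt0 _ (ltr0n R 2)) (lt_le_trans ltr01).
  (* With time clamped to [[0, 1]], [F] equals [h \o phi] away from the origin, which settles
     continuity at radius 1/2. *)
  pose phi y := (Num.max 0 (Num.min 1 (2 * enorm y - 1)), normalize y).
  have y0 : \forall y \near x, 0 < enorm y by exact: (cvgr_gt _ ce _ x0).
  have S01 y : 0 < enorm y -> (`[0, 1]%classic `*` S) (phi y).
    move=> y0'; split=> /=; last exact: sphere_normalize.
    by rewrite in_itv /= le_max lexx ge_max ler01 ge_min lexx.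
  have FE y : 0 < enorm y -> F y = h (phi y).
    move=> y0'; rewrite /F /phi; case: leP => y1.
      rewrite (max_idPl _); last by rewrite ge_min subr_le0 y1 orbT.
      by rewrite h0 //; exact: sphere_normalize.
    by rewrite (max_idPr _) // le_min ler01 subr_ge0 ltW.
  rewrite FE //.
  have : h (phi y) @[y --> x] --> h (phi x).
    apply: (cvg_comp phi h _ (hc (phi x) (S01 x x0))).
    apply: cvg_to_within; last by near=> y; apply: S01; near: y; exact: y0.
    have c1 : Num.max 0 (Num.min 1 (2 * enorm y - 1)) @[y --> x] -->
        Num.max 0 (Num.min 1 (2 * enorm x - 1)).
      apply: cvg_maxr; first exact: cvg_cst.
      apply: cvg_minr; first exact: cvg_cst.
      by apply: (cvgB ce2); exact: cvg_cst.
    have c2 : normalize y @[y --> x] --> normalize x.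
      by apply: (@cvg_normalize _ (nbhs x) FFx id x) => // i; exact: coord_continuous.
    exact: (cvg_pair c1 c2).
  apply: cvg_trans; apply: near_eq_cvg.
  by near=> y; apply/esym/FE; near: y; exact: y0.
have Fb x i : `|x 0 i| = 1 -> F x 0 i = (enorm x)^-1 * x 0 i.
  move=> xi; have x1 : 1 <= enorm x by rewrite -xi ler_coord_enorm.
  have x2 : 2 <= 2 * enorm x by rewrite ler_peMr.
  rewrite /F ifF; last by apply/negbTE; rewrite -ltNge (lt_le_trans _ x2) // ltr1n.
  rewrite (min_idPl _); last by rewrite lerBrDr.
  by rewrite h1 ?mxE //; apply: sphere_normalize; exact: lt_le_trans ltr01 x1.
have [x Fx0] : exists x, F x = 0.
  apply: poincare_miranda => // x i _ xi.
    by rewrite Fb xi ?normrN1 // mulrN1 oppr_le0 invr_ge0 enorm_ge0.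
  by rewrite Fb xi ?normr1 // mulr1 invr_ge0 enorm_ge0.
by have [i] := sphere_neq0 (FS x); rewrite Fx0 mxE eqxx.
Unshelve. all: by end_near.
Qed.

(** Through [f] and [g], a contraction of [K] to [p] becomes a contraction of the sphere to
    [f p]. *)
Lemma contractible_not_sphere (X : topologicalType) (K : set X) (p : X) :
  K p -> homotopic R K K (fun=> p) id -> ~ homotopy_equivalent R K S.
Proof.
move=> Kp [H2 [/subspace_continuousP H2c H2K H20 H21]].
move=> [f [g [[/subspace_continuousP fc fS] [/subspace_continuousP gc gK] _]]].
move=> [H1 [/subspace_continuousP H1c H1S H10 H11]].
apply: (@sphere_not_contractible (f p)); first exact: fS.
pose t1 (s : R) : R := Num.min 1 (2 * s).
pose t2 (s : R) : R := Num.max 0 (2 * s - 1).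
have t1I s : 0 <= s -> `[0, 1]%classic (t1 s).
  by move=> s0; rewrite /= in_itv /= le_min ler01 ge_min lexx mulr_ge0.
have t2I s : s <= 1 -> `[0, 1]%classic (t2 s).
  move=> s1; rewrite /= in_itv /= le_max lexx ge_max ler01 lerBlDr.
  by rewrite -[1 + 1]/(2%:R) ler_piMr.
(* Concatenation of [f \o H2 \o g] and [H1]: on each half of the interval, two
   of the three terms cancel. *)
pose h (z : R * 'rV[R]_n) : 'rV[R]_n :=
  f (H2 (t1 z.1, g z.2)) + H1 (t2 z.1, z.2) - f (g z.2).
apply: (homotopicI (h := h)).
- move=> s u /andP[s0 s1] Su; set F := within _ _.
  have c1 : z.1 @[z --> F] --> s by exact: cvg_fst_within.
  have c2 : z.2 @[z --> F] --> u by exact: cvg_snd_within.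
  have FA : \forall z \near F, (0 <= z.1 <= 1) /\ S z.2.
    by apply: filterS (near_within _ _) => z [/=]; rewrite in_itv.
  have c12 : 2 * z.1 @[z --> F] --> 2 * s by apply: cvgM => //; exact: cvg_cst.
  have cg : g z.2 @[z --> F] --> within K (nbhs (g u)).
    apply: cvg_to_within; last by apply: filterS FA => z [_ /gK].
    apply: (cvg_comp (fun z : R * 'rV[R]_n => z.2) g _ (gc u Su)).
    by apply: cvg_to_within c2 _; apply: filterS FA => z [].
  have cfg : f (g z.2) @[z --> F] --> f (g u).
    exact: (cvg_comp (fun z : R * 'rV[R]_n => g z.2) f cg (fc _ (gK _ Su))).
  have cH1 : H1 (t2 z.1, z.2) @[z --> F] --> H1 (t2 s, u).
    apply: (cvg_comp (fun z : R * 'rV[R]_n => (t2 z.1, z.2)) H1 _ (H1c (t2 s, u) _)).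
      apply: cvg_to_within; last first.
        by apply: filterS FA => z [/andP[_ z1] Sz]; split=> //; exact: t2I.
      have ct2 : t2 z.1 @[z --> F] --> t2 s.
        by apply: cvg_maxr; [exact: cvg_cst|apply: cvgB => //; exact: cvg_cst].
      exact: (cvg_pair ct2 c2).
    by split=> //; exact: t2I.
  have H2in : (`[0, 1]%classic `*` K) (t1 s, g u) by split; [exact: t1I|exact: gK].
  have cH2 : H2 (t1 z.1, g z.2) @[z --> F] --> H2 (t1 s, g u).
    apply: (cvg_comp (fun z : R * 'rV[R]_n => (t1 z.1, g z.2)) H2 _ (H2c _ H2in)).
    apply: cvg_to_within; last first.
      by apply: filterS FA => z [/andP[z0 _] Sz]; split; [exact: t1I|exact: gK].
    have ct1 : t1 z.1 @[z --> F] --> t1 s by apply: cvg_minr => //; exact: cvg_cst.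
    have cg' : g z.2 @[z --> F] --> g u by exact: cvg_trans cg (cvg_within _).
    exact: (cvg_pair ct1 cg').
  have cfH2 : f (H2 (t1 z.1, g z.2)) @[z --> F] --> f (H2 (t1 s, g u)).
    apply: (cvg_comp (fun z : R * 'rV[R]_n => H2 (t1 z.1, g z.2)) f _ (fc _ _)).
      apply: cvg_to_within => //.
      by apply: filterS FA => z [/andP[z0 _] Sz]; apply: H2K; [exact: t1I|exact: gK].
    by case: H2in; exact: H2K.
  apply: cvg_rV => i; rewrite !mxE; under eq_cvg do rewrite !mxE.
  by apply: cvgB; [apply: cvgD|]; exact: cvg_coord.
- move=> s u /andP[s0 s1] Su; rewrite /h /=.
  have [s2|s2] := leP (2 * s) 1.
    have -> : t2 s = 0 by apply/max_idPl; rewrite subr_le0.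
    by rewrite H10 // addrK; apply/fS/H2K; [exact: t1I|exact: gK].
  have -> : t1 s = 1 by apply/min_idPl/ltW.
  rewrite H21; last exact: gK.
  by rewrite addrAC subrr add0r; apply: H1S => //; exact: t2I.
- move=> u Su; rewrite /h /=.
  have -> : t1 0 = 0 by rewrite /t1 mulr0; apply/min_idPr.
  have -> : t2 0 = 0 by apply/max_idPl; rewrite mulr0 sub0r lerN10.
  by rewrite H10 // H20 ?addrK //; exact: gK.
- move=> u Su; rewrite /h /=.
  have -> : t1 1 = 1 by apply/min_idPl; rewrite mulr1 ler1n.
  have -> : t2 1 = 1.
    by rewrite /t2 mulr1 (_ : 2 - 1 = 1 :> R) ?(max_idPr _) // -[X in X - _]natr1 addrK.
  rewrite H21; last exact: gK.
  by rewrite H11 // addrAC subrr add0r.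
Qed.

End Sphere.

(** * Sphericity and the nucleus of the top element *)

Section Contractible.
Local Open Scope ring_scope.
Context {d : Order.disp_t} (L : finTBLatticeType d) (R : realType).
Implicit Types (x y z : L).

Lemma barycentric_vertex x : x != \bot%O -> x != \top%O ->
  @barycentric d L R (fun y => (y == x)%:R).
Proof.
move=> x0 x1; split=> [y||]; first by rewrite ler0n.
  rewrite (bigD1 x) //= eqxx big1 ?addr0 // => y /negbTE->.
  by [].
apply/order_complexP.
have sx y : y \in supp_set (fun y => (y == x)%:R : R) -> y = x.
  by rewrite inE; have [//|] := eqVneq y x; rewrite eqxx.
split=> [y /sx->//|y z /sx-> /sx->].
by rewrite /Order.comparable lexx.
Qed.

Lemma lt_top_join_nucleus x : (x < \top)%O -> (x `|` nucleus \top < \top)%O.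
Proof.
move=> x1; have [c xc cc] := coatom_ge x1.
by apply: le_lt_trans (covers_lt cc); rewrite leUx xc nucleus_le.
Qed.

(** If the nucleus [c] is not [\bot], joining with [c] is a closure operator on the proper part with
    all values above [c], so the constant map at the vertex [c] is homotopic to the identity. *)
Lemma spherical_nucleus : spherical R L -> nucleus \top%O = \bot%O :> L.
Proof.
move=> [n eqS]; apply/eqP; apply: contraT => c0.
have c1 : nucleus \top%O != \top%O :> L.
  rewrite -ltx1; have : (\bot < \top :> L)%O.
    by rewrite lt0x; apply: contraNneq c0 => e; rewrite -lex0 -e lex1.
  by move=> /lt_top_join_nucleus; rewrite join0x.
set c := nucleus \top%O in c0 c1.
pose p : 'rV[R]_#|L| := of_weight (fun y => (y == c)%:R).
have Kp : realization (order_complex L) p.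
  exact/realization_of_weight/barycentric_vertex.
exfalso; apply: (contractible_not_sphere Kp _ eqS).
have cp x : x != \bot%O -> x != \top%O ->
    (x `|` c)%O != \bot%O /\ (x `|` c)%O != \top%O.
  move=> x0 x1; rewrite -ltx1 lt_top_join_nucleus ?ltx1 //.
  by split=> //; apply: contraNneq x0 => e; rewrite -lex0 -e leUl.
apply: (@closure_homotopic _ _ _ (fun x => x `|` c)%O) => //.
- by move=> x y xy; exact: leU2.
- by move=> x; exact: leUl.
- by move=> v _; exact: cvg_cst.
move=> v /realizationP[_ _ /order_complexP[vp vc]].
have sp x : x \in supp_set (weight p) -> x = c.
  by rewrite inE weightK; have [//|] := eqVneq x c; rewrite eqxx.
apply/order_complexP; split.
  move=> z /finset.setUP[/imsetP[x /vp[x0 x1] ->]|/sp->]; last by [].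
  exact: cp.
move=> y z /finset.setUP[/imsetP[x xv ->]|/sp->] /finset.setUP[/imsetP[x' xv' ->]|/sp->].
- by have /orP[xx|xx] := vc _ _ xv xv'; apply/orP; [left|right]; exact: leU2.
- by rewrite /Order.comparable leUr orbT.
- by rewrite /Order.comparable leUr.
- by rewrite /Order.comparable lexx.
Qed.

End Contractible.

(** * The order complex when the coatoms are prime and meet in the bottom element *)

Section Coatoms.
Local Open Scope ring_scope.
Context {d : Order.disp_t} (L : finTBLatticeType d) (R : realType).
Variables (n : nat) (c : 'I_n.+1 -> L) (J : 'I_n.+1 -> L).
Hypothesis c_coatom : forall i, covers (c i) (\top%O : L).
Hypothesis coatom_c : forall y : L, covers y \top%O -> exists i, y = c i.
Hypothesis c_inj : injective c.
Hypothesis c_prime : forall i x, (x <= c i)%O = ~~ (J i <= x)%O.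
Hypothesis nucleus0 : nucleus \top%O = \bot%O :> L.
Implicit Types (x : L) (A B : {set 'I_n.+1}) (i j : 'I_n.+1).

Definition coatoms_Nge x : {set 'I_n.+1} := [set i | ~~ (x <= c i)%O]%SET.
Definition meet_coatoms A : L := (\meet_(i | i \notin A) c i)%O.
Local Notation N := coatoms_Nge.
Local Notation m := meet_coatoms.

Lemma Nge_mono x y : (x <= y)%O -> N x \subset N y.
Proof.
by move=> xy; apply/fintype.subsetP=> i; rewrite !inE; apply: contra; exact: le_trans.
Qed.

Lemma Nge_neq0 x : x != \bot%O -> exists i, i \in N x.
Proof.
move=> x0; apply/existsP; apply: contraNT x0 => /existsPn h.
rewrite -lex0 -nucleus0; apply/meetsP => y /coatom_c[i ->].
by have := h i; rewrite inE negbK.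
Qed.

Lemma Nge_neqT x : x != \top%O -> exists i, i \notin N x.
Proof.
rewrite -ltx1 => /coatom_ge[y xy /coatom_c[i yi]]; exists i.
by rewrite inE negbK -yi.
Qed.

Lemma le_meet_Nge x : (x <= m (N x))%O.
Proof. by apply/meetsP => i; rewrite inE negbK. Qed.

Lemma meet_coatoms_mono A B : A \subset B -> (m A <= m B)%O.
Proof.
move=> /fintype.subsetP AB; apply/meetsP=> i iB; apply: meets_inf.
by apply: contra iB => /AB.
Qed.

(* Primeness of the coatoms makes the meet semilattice they generate boolean. *)
Lemma Nge_meet A : N (m A) = A.
Proof.
apply/finset.setP=> i; rewrite inE; have [iA|iA] := boolP (i \in A); last first.
  by apply/negbTE; rewrite negbK; exact: meets_inf.
rewrite c_prime negbK; apply/meetsP=> k kA; apply: contraT; rewrite -c_prime => ki.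
have kc := c_coatom k; have := covers_lt (c_coatom i).
move: ki; rewrite le_eqVlt => /predU1P[/c_inj ki|ki].
  by rewrite ki iA in kA.
by rewrite (covers_between kc ki (lex1 _)) ltxx.
Qed.

Definition nontrivial A := (A != finset.set0) && (A != [set: 'I_n.+1]%SET).

Lemma nontrivialP A :
  reflect ((exists i, i \in A) /\ exists i, i \notin A) (nontrivial A).
Proof.
apply: (iffP andP) => [[/finset.set0Pn[i iA] AT]|[[i iA] [j jA]]].
  split; first by exists i.
  apply/existsP; apply: contraNT AT => /existsPn h; apply/eqP/finset.setP=> j.
  by rewrite inE; have := h j; rewrite negbK.
split; first by apply/finset.set0Pn; exists i.
by apply: contraNneq jA => ->; rewrite inE.
Qed.

Lemma meet_coatoms_proper A : nontrivial A -> m A != \bot%O /\ m A != \top%O.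
Proof.
move=> /nontrivialP[[i iA] [j jA]]; split.
  by apply: contraTneq iA => mA; rewrite -(Nge_meet A) mA inE le0x.
apply: contraNneq jA => mA; rewrite -(Nge_meet A) mA inE.
by rewrite lt_geF // covers_lt.
Qed.

Lemma Nge_nontrivial x : x != \bot%O -> x != \top%O -> nontrivial (N x).
Proof. by move=> x0 x1; apply/nontrivialP; split; [exact: Nge_neq0|exact: Nge_neqT]. Qed.

(** A weighted sum of indicators of the sets [N x]. On a chain these sets are nested, and they are
    the nontrivial superlevel sets of the height. *)
Definition height (w : L -> R) i : R := \sum_(x | i \in N x) w x.

Lemma height_le w i j : (forall x, 0 <= w x) ->
  (forall x, x \in supp_set w -> i \in N x -> j \in N x) ->
  height w i <= height w j.
Proof.
move=> w0 ij; rewrite /height big_mkcond [X in _ <= X]big_mkcond /=.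
apply: ler_sum => x _; have [wx|wx] := eqVneq (w x) 0; first by rewrite wx !if_same.
have xs : x \in supp_set w by rewrite inE.
by case: ifP => iN; [rewrite (ij _ xs iN)|case: ifP].
Qed.

Lemma height_lt w i j x : (forall x, 0 <= w x) ->
  (forall x, x \in supp_set w -> i \in N x -> j \in N x) ->
  x \in supp_set w -> i \notin N x -> j \in N x -> height w i < height w j.
Proof.
move=> w0 ij xs iN jN; rewrite /height [X in _ < X](bigD1 x) //=.
have wx : 0 < w x by rewrite lt_def w0 andbT; move: xs; rewrite inE.
rewrite -[X in X < _]add0r; apply: ltr_leD => //.
rewrite big_mkcond [X in _ <= X]big_mkcond /=.
apply: ler_sum => y _; have [wy|wy] := eqVneq (w y) 0; first by rewrite wy !if_same.
have ys : y \in supp_set w by rewrite inE.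
case: ifP => iy; last by case: ifP.
rewrite (ij _ ys iy) /=.
by rewrite ifT //; apply: contraNneq iN => <-.
Qed.

Lemma height_eq1 w i : barycentric w ->
  (forall x, x \in supp_set w -> i \in N x) -> height w i = 1.
Proof.
move=> [_ <- _] h; rewrite /height [RHS](bigID (fun x => i \in N x)) /=.
rewrite [X in _ = _ + X]big1 ?addr0 // => x; apply: contraNeq => wx.
by apply: h; rewrite inE.
Qed.

Lemma height_eq0 w j :
  (forall x, x \in supp_set w -> j \notin N x) -> height w j = 0.
Proof.
by move=> h; rewrite /height big1 // => x; apply: contraTeq => wx; apply: h; rewrite inE.
Qed.

(** For [x] in the support, [N x] contains the set of the least element and is contained in that of
    the greatest; both are nontrivial. *)
Lemma height_nonconstant w : barycentric w ->
  exists i j, height w i = 1 /\ height w j = 0.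
Proof.
move=> bw; have [w0 w1 /order_complexP[wp wc]] := bw.
have [x xs] := barycentric_neq0 bw.
have [a _ [aS amin]] := ex_minimal_le (P := fun x => x \in supp_set w) xs.
have [b _ [bS bmax]] := ex_maximal_ge (P := fun x => x \in supp_set w) xs.
have [i iN] := Nge_neq0 (proj1 (wp a aS)).
have [j jN] := Nge_neqT (proj2 (wp b bS)).
exists i, j; split.
  apply: height_eq1 => // y yS; apply: (fintype.subsetP (Nge_mono _)) iN.
  by have /orP[//|ya] := wc a y aS yS; rewrite (amin y yS ya).
apply: height_eq0 => y yS; apply: contra jN; apply: (fintype.subsetP (Nge_mono _)).
by have /orP[//|ya] := wc y b yS bS; rewrite (bmax y yS ya).
Qed.

(** Continuous in [y], and nonzero only if [A] is a superlevel set of [y], so the sets of nonzero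
    weight are nested. Empty products give the trivial sets weight 1, whence the restriction to
    nontrivial sets below. *)
Definition level_weight (y : 'I_n.+1 -> R) A : R :=
  \prod_(i in A) \prod_(j in ~: A) Num.max 0 (y i - y j).

Lemma level_weight_ge0 y A : 0 <= level_weight y A.
Proof. by apply: prodr_ge0 => i _; apply: prodr_ge0 => j _; rewrite le_max lexx. Qed.

Lemma level_weight_neq0 y A :
  level_weight y A != 0 <-> forall i j, i \in A -> j \notin A -> y j < y i.
Proof.
split=> [h i j iA jA|h].
  move: h; rewrite /level_weight => /prodf_neq0/(_ i iA)/prodf_neq0/(_ j).
  rewrite inE => /(_ jA); apply: contraNlt => yij.
  by apply/eqP/max_idPl; rewrite subr_le0.
apply/prodf_neq0 => i iA; apply/prodf_neq0 => j; rewrite inE => jA.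
have ji : 0 < y i - y j by rewrite subr_gt0 h.
by rewrite (max_idPr _) ?gt_eqF // ltW.
Qed.

Definition total_weight y : R := \sum_(A | nontrivial A) level_weight y A.
Definition level_point y x : R :=
  (\sum_(A | nontrivial A && (m A == x)) level_weight y A) / total_weight y.

(** The set where [y] is maximal is nontrivial and has positive weight. *)
Lemma total_weight_gt0 y i j : y i != y j -> 0 < total_weight y.
Proof.
move=> yij.
have [k _ kmax] := @arg_maxP _ _ _ ord0 xpredT y isT.
pose A := [set l | y l == y k]%SET.
have ntA : nontrivial A.
  apply/nontrivialP; split; first by exists k; rewrite inE.
  have [yi|yi] := eqVneq (y i) (y k); last by exists i; rewrite inE.
  by exists j; rewrite inE -yi eq_sym.
rewrite /total_weight (bigD1 A) //= ltr_wpDr //.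
  by apply: sumr_ge0 => B _; exact: level_weight_ge0.
rewrite lt_def level_weight_ge0 andbT; apply/level_weight_neq0 => a b.
by rewrite !inE => /eqP-> byk; rewrite lt_neqAle byk; exact: kmax.
Qed.

Lemma level_pointP y x : level_point y x != 0 ->
  exists A, [/\ nontrivial A, m A = x & level_weight y A != 0].
Proof.
rewrite /level_point mulf_eq0 negb_or => /andP[h _].
have [A /andP[ntA /eqP mA] wA] :
    exists2 A, nontrivial A && (m A == x) & level_weight y A != 0.
  apply/exists_inP; apply: contraNT h => /exists_inPn h.
  by rewrite big1 // => A /h; rewrite negbK => /eqP.
by exists A.
Qed.

Lemma level_sets_chain y A B : level_weight y A != 0 -> level_weight y B != 0 ->
  A \subset B \/ B \subset A.
Proof.
move=> /level_weight_neq0 wA /level_weight_neq0 wB.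
have [|/fintype.subsetPn[i iA iB]] := boolP (A \subset B); first by left.
right; apply/fintype.subsetP=> j jB; apply: contraT => jA.
by have := lt_trans (wA i j iA jA) (wB j i jB iB); rewrite ltxx.
Qed.

Lemma barycentric_level_point y i j : y i != y j -> barycentric (level_point y).
Proof.
move=> yij; have W0 := total_weight_gt0 yij; split.
- move=> x; rewrite divr_ge0 ?(ltW W0) //; apply: sumr_ge0 => A _.
  exact: level_weight_ge0.
- rewrite -big_distrl /= -(partition_big m xpredT) //= divff //.
  by rewrite gt_eqF.
- apply/order_complexP; split.
    by move=> x; rewrite inE => /level_pointP[A [ntA <- _]]; exact: meet_coatoms_proper.
  move=> x z; rewrite !inE => /level_pointP[A [_ <- wA]] /level_pointP[B [_ <- wB]].
  by have [] := level_sets_chain wA wB => /meet_coatoms_mono; rewrite /Order.comparable => ->;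
    rewrite ?orbT.
Qed.

(** Every nontrivial set of nonzero weight contains the maximizers of [y] and omits the
    minimizers. *)
Lemma height_level_point y i j : (forall k, y j <= y k <= y i) -> y j < y i ->
  height (level_point y) i = 1 /\ height (level_point y) j = 0.
Proof.
move=> yk yji.
have bl : barycentric (level_point y).
  by apply: (@barycentric_level_point y j i); rewrite lt_eqF.
split; [apply: height_eq1 => // x|apply: height_eq0 => x];
  rewrite inE => /level_pointP[A [ntA <- /level_weight_neq0 wA]]; rewrite Nge_meet;
  have /nontrivialP[[a aA] [b bA]] := ntA.
  apply: contraT => iA; have := wA a i aA iA; rewrite ltNge.
  by have /andP[_ ->] := yk a.
apply/negP=> jA; have := wA j b jA bA; rewrite ltNge.
by have /andP[-> _] := yk b.
Qed.

(** Up to a constant and positive scaling [y] is the height of [w], so its nontrivial superlevel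
    sets are sets [N x'] with [x'] in the support of [w]. *)
Lemma level_point_height w (y : 'I_n.+1 -> R) (a : R) x :
  barycentric w -> 0 < a -> (forall i j, y i - y j = a * (height w i - height w j)) ->
  level_point y x != 0 -> exists2 x', x' \in supp_set w & m (N x') = x.
Proof.
move=> [w0 w1 /order_complexP[wp wc]] a0 yE.
move=> /level_pointP[A [ntA <- /level_weight_neq0 wA]].
have hA i j : i \in A -> j \notin A -> height w j < height w i.
  by move=> iA jA; have := wA i j iA jA; rewrite -subr_gt0 yE pmulr_rgt0 // subr_gt0.
have /nontrivialP[[i0 i0A] [j0 j0A]] := ntA.
(* [i] has least height in [A] and [j] greatest height outside. As [j] is lower than [i], some [x']
   in the support separates them, and any index misplaced by [N x'] would contradict the choice of
   [i] or [j]. *)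
have [i iA imin] := @arg_minP _ _ _ i0 (mem A) (height w) i0A.
have [j jA jmax] := @arg_maxP _ _ _ j0 (fun j => j \notin A) (height w) j0A.
have [x' xs /andP[iN jN]] :
    exists2 x', x' \in supp_set w & (i \in N x') && (j \notin N x').
  apply/exists_inP; apply: contraT => /exists_inPn h.
  have := hA i j iA jA; rewrite ltNge height_le // => z zs iz.
  by have := h z zs; rewrite negb_and iz negbK.
(* The sets [N z] are nested: one containing an index outside [N x'] contains all of [N x']. *)
have cmp z : z \in supp_set w -> forall k l, k \notin N x' -> l \in N x' ->
    k \in N z -> l \in N z.
  move=> zs k l kN lN kz.
  have /orP[zx|xz] := wc z x' zs xs.
    by rewrite (fintype.subsetP (Nge_mono zx) k kz) in kN.
  exact: (fintype.subsetP (Nge_mono xz)).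
exists x' => //; congr m; apply/finset.setP=> k.
have [kA|kA] := boolP (k \in A).
  apply: contraT => kN; have := imin k kA; rewrite /= leNgt.
  by rewrite (height_lt w0 _ xs kN iN) // => z zs; exact: cmp.
apply/negbTE/negP => kN; have := jmax k kA; rewrite /= leNgt.
by rewrite (height_lt w0 _ xs jN kN) // => z zs; exact: cmp.
Qed.

Local Open Scope classical_set_scope.

(** Functions on the coatoms modulo constants are identified with ['rV[R]_n] by making the value at
    [ord_max] zero. *)
Definition differences (y : 'I_n.+1 -> R) : 'rV[R]_n :=
  \row_k (y (lift ord_max k) - y ord_max).
Definition extend0 (u : 'rV[R]_n) i : R :=
  if unlift ord_max i is Some k then u 0 k else 0.

Lemma extend0_lift u k : extend0 u (lift ord_max k) = u 0 k.
Proof. by rewrite /extend0 liftK. Qed.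

Lemma extend0_max u : extend0 u ord_max = 0.
Proof. by rewrite /extend0 unlift_none. Qed.

Lemma extend0K u : differences (extend0 u) = u.
Proof. by apply/rowP=> k; rewrite mxE extend0_lift extend0_max subr0. Qed.

Lemma extend0_differences y i : extend0 (differences y) i = y i - y ord_max.
Proof.
by rewrite /extend0; case: unliftP => [k|] ->; rewrite ?mxE // subrr.
Qed.

Lemma enorm_differences_gt0 y i j : y i != y j -> 0 < enorm (differences y).
Proof.
move=> yij.
have [k yk] : exists k, y k != y ord_max.
  have [yi|yi] := eqVneq (y i) (y ord_max); last by exists i.
  by exists j; rewrite -yi eq_sym.
have [l kl] : exists l, k = lift ord_max l.
  by case: (unliftP ord_max k) => [l ->|kM]; [exists l|rewrite kM eqxx in yk].
by apply: (@enorm_gt0 _ _ _ l); rewrite mxE -kl subr_eq0.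
Qed.

Local Notation K := (@realization R L (order_complex L)).
Local Notation S := (@sphere R n).

Definition to_sphere (v : 'rV[R]_#|L|) := normalize (differences (height (weight v))).
Definition of_sphere (u : 'rV[R]_n) : 'rV[R]_#|L| := of_weight (level_point (extend0 u)).

Lemma to_sphere_gt0 v : K v -> 0 < enorm (differences (height (weight v))).
Proof.
move=> /realizationP/height_nonconstant[i [j [hi hj]]].
by apply: (@enorm_differences_gt0 _ i j); rewrite hi hj oner_eq0.
Qed.

Lemma to_sphereP v : K v -> S (to_sphere v).
Proof. by move=> Kv; apply/sphere_normalize/to_sphere_gt0. Qed.

Lemma sphere_nonconstant u : S u -> exists i j, extend0 u i != extend0 u j.
Proof.
move=> /sphere_neq0[k uk]; exists (lift ord_max k), ord_max.
by rewrite extend0_lift extend0_max.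
Qed.

Lemma of_sphereP u : S u -> K (of_sphere u).
Proof.
move=> /sphere_nonconstant[i [j ij]].
exact/realization_of_weight/(barycentric_level_point ij).
Qed.

Section Cvg.
Context {T : Type} {F : set_system T} {FF : Filter F}.

Lemma cvg_height (f : T -> 'rV[R]_#|L|) v i : f t @[t --> F] --> v ->
  height (weight (f t)) i @[t --> F] --> height (weight v) i.
Proof. by move=> fv; apply: cvg_sumr => x _; exact: cvg_coord. Qed.

Lemma cvg_differences (f : T -> 'I_n.+1 -> R) y :
  (forall i, f t i @[t --> F] --> y i) ->
  forall k, differences (f t) 0 k @[t --> F] --> differences y 0 k.
Proof.
by move=> fy k; rewrite mxE; under eq_cvg do rewrite mxE; exact: cvgB.
Qed.

Lemma cvg_to_sphere (f : T -> 'rV[R]_#|L|) v : K v -> f t @[t --> F] --> v ->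
  to_sphere (f t) @[t --> F] --> to_sphere v.
Proof.
move=> Kv fv; apply: cvg_normalize; last exact: to_sphere_gt0.
by apply: cvg_differences => i; exact: cvg_height.
Qed.

Lemma cvg_extend0 (f : T -> 'rV[R]_n) u i : f t @[t --> F] --> u ->
  extend0 (f t) i @[t --> F] --> extend0 u i.
Proof.
move=> fu; rewrite /extend0; case: unliftP => [k _|_]; last exact: cvg_cst.
exact: cvg_coord.
Qed.

Lemma cvg_level_weight (f : T -> 'I_n.+1 -> R) y A :
  (forall i, f t i @[t --> F] --> y i) ->
  level_weight (f t) A @[t --> F] --> level_weight y A.
Proof.
move=> fy; apply: cvg_prodr => i _; apply: cvg_prodr => j _.
by apply: cvg_maxr; [exact: cvg_cst|exact: cvgB].
Qed.

Lemma cvg_of_sphere (f : T -> 'rV[R]_n) u : S u -> f t @[t --> F] --> u ->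
  of_sphere (f t) @[t --> F] --> of_sphere u.
Proof.
move=> /sphere_nonconstant[i [j ij]] fu.
have cw A : level_weight (extend0 (f t)) A @[t --> F] --> level_weight (extend0 u) A.
  by apply: cvg_level_weight => k; exact: cvg_extend0.
apply: cvg_rV => k; rewrite mxE; under eq_cvg do rewrite mxE.
apply: cvgM; first by apply: cvg_sumr => A _; exact: cw.
apply: cvgV; first by rewrite gt_eqF // (total_weight_gt0 ij).
by apply: cvg_sumr => A _; exact: cw.
Qed.

End Cvg.

(** The segment between the two functions, normalized. It never meets a constant, as both ends are
    larger at a maximizer of [extend0 u] than at a minimizer. *)
Lemma to_of_sphere_homotopic : homotopic R S S (to_sphere \o of_sphere) id.
Proof.
pose z u := height (weight (of_sphere u)).
pose mix (p : R * 'rV[R]_n) i := (1 - p.1) * z p.2 i + p.1 * extend0 p.2 i.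
have mix_gt0 s u : 0 <= s <= 1 -> S u -> 0 < enorm (differences (mix (s, u))).
  move=> /andP[s0 s1] Su; have [i0 [j0 ij]] := sphere_nonconstant Su.
  have [i _ imax] := @arg_maxP _ _ _ ord0 xpredT (extend0 u) isT.
  have [j _ jmin] := @arg_minP _ _ _ ord0 xpredT (extend0 u) isT.
  have ji : extend0 u j < extend0 u i.
    rewrite ltNge; apply: contra ij => le_ij.
    have cst k : extend0 u k = extend0 u i.
      apply/eqP; rewrite eq_le; apply/andP; split; first exact: imax.
      exact: le_trans le_ij (jmin _ isT).
    by rewrite !cst.
  have [] := @height_level_point (extend0 u) i j _ ji.
    by move=> k; apply/andP; split; [exact: jmin|exact: imax].
  have zE : z u = height (level_point (extend0 u)).
    by rewrite /z; congr height; apply: funext => x; rewrite weightK.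
  rewrite -zE => zi zj.
  apply: (@enorm_differences_gt0 _ i j); rewrite /mix /= zi zj mulr0 mulr1 add0r.
  rewrite -subr_eq0 -addrA -mulrBr gt_eqF //.
  have [->|sN0] := eqVneq s 0; first by rewrite subr0 mul0r addr0.
  by rewrite ltr_wpDl ?subr_ge0 // mulr_gt0 ?subr_gt0 // lt_def sN0.
apply: (homotopicI (h := fun p => normalize (differences (mix p)))).
- move=> s u s01 Su; set F := within _ _.
  have c1 : p.1 @[p --> F] --> s by exact: cvg_fst_within.
  have c2 : p.2 @[p --> F] --> u by exact: cvg_snd_within.
  apply: cvg_normalize; last exact: mix_gt0.
  apply: cvg_differences => i; apply: cvgD.
    apply: cvgM; first by apply: cvgB => //; exact: cvg_cst.
    by apply: cvg_height; exact: cvg_of_sphere.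
  by apply: cvgM => //; exact: cvg_extend0.
- by move=> s u s01 Su; apply/sphere_normalize/mix_gt0.
- move=> u Su; rewrite /= /to_sphere; congr (normalize (differences _)).
  by apply: funext => i; rewrite /mix /= subr0 mul1r mul0r addr0.
- move=> u Su; rewrite -[RHS]normalize_sphere // -[in RHS](extend0K u).
  congr (normalize (differences _)).
  by apply: funext => i; rewrite /mix /= subrr mul0r mul1r add0r.
Qed.

(** By [level_point_height] the image of [v] is supported in the closure of the support of [v],
    which is a chain, so the hypothesis of [closure_homotopic] on supports holds. *)
Lemma of_to_sphere_homotopic : homotopic R K K (of_sphere \o to_sphere) id.
Proof.
apply: (@closure_homotopic _ _ _ (fun x => m (N x))).
- by move=> x x0 x1; apply: meet_coatoms_proper; exact: Nge_nontrivial.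
- by move=> x y xy; apply/meet_coatoms_mono/Nge_mono.
- exact: le_meet_Nge.
- move=> v Kv; apply: cvg_of_sphere; first exact: to_sphereP.
  by apply: cvg_to_sphere => //; exact: cvg_within.
- by move=> v Kv; exact/of_sphereP/to_sphereP.
move=> v Kv; have bv : barycentric (weight v) by apply/realizationP.
have [_ _ /order_complexP[vp vc]] := bv.
rewrite (finset.setUidPl _); last first.
  apply/fintype.subsetP=> x; rewrite inE weightK => lx.
  pose y := height (weight v); pose a := (enorm (differences y))^-1.
  have [||x' xs <-] := level_point_height bv (a := a) _ _ lx.
  - by rewrite invr_gt0 to_sphere_gt0.
  - move=> i j; rewrite /to_sphere /normalize -/y -/a.
    have sE k : extend0 (a *: differences y) k = a * (y k - y ord_max).
      rewrite -extend0_differences /extend0; case: unliftP => [l _|_]; last by rewrite mulr0.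
      by rewrite mxE.
    by rewrite !sE -mulrBr opprB addrA subrK.
  exact: imset_f.
apply/order_complexP; split.
  move=> z /imsetP[x /vp[x0 x1] ->].
  by apply: meet_coatoms_proper; exact: Nge_nontrivial.
move=> y z /imsetP[x xv ->] /imsetP[x' xv' ->].
by have /orP[xx|xx] := vc _ _ xv xv'; apply/orP; [left|right];
  exact/meet_coatoms_mono/Nge_mono.
Qed.

Lemma coatoms_homotopy_equivalent : homotopy_equivalent R K S.
Proof.
exists to_sphere, of_sphere; split.
- split; last exact: to_sphereP.
  by apply/subspace_continuousP=> v Kv; apply: cvg_to_sphere => //; exact: cvg_within.
- split; last exact: of_sphereP.
  by apply/subspace_continuousP=> u Su; apply: cvg_of_sphere => //; exact: cvg_within.
- exact: of_to_sphere_homotopic.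
- exact: to_of_sphere_homotopic.
Qed.

End Coatoms.

Section Spherical.
Local Open Scope classical_set_scope.
Local Open Scope ring_scope.
Context {d : Order.disp_t} (L : finTBLatticeType d) (R : realType).

Lemma homotopy_equivalent_set0 (X Y : ptopologicalType) (A : set X) (B : set Y) :
  A = set0 -> B = set0 -> homotopy_equivalent R A B.
Proof.
move=> -> ->; exists (fun=> point), (fun=> point); split; try split; try by [].
- by apply/subspace_continuousP.
- by apply/subspace_continuousP.
- by exists snd; split=> //; apply/subspace_continuousP => -[s x] [].
- by exists snd; split=> //; apply/subspace_continuousP => -[s x] [].
Qed.

Lemma nucleus_spherical : {in JI L &, injective (@cg_ji d L)} ->
  nucleus \top%O = \bot%O :> L -> spherical R L.
Proof.
move=> cg_inj n0.
pose C := [set y | covers y (\top%O : L)]%SET.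
case Cn : #|C| => [|n].
  (* Without coatoms the lattice has one element; the complex is empty, like the sphere of dimension
     -1. *)
  exists 0%N; apply: homotopy_equivalent_set0.
    apply/seteqP; split=> // v /realizationP bv.
    have [x xs] := barycentric_neq0 bv; have [_ _ /order_complexP[vp _]] := bv.
    have [_] := vp x xs; rewrite -ltx1 => /coatom_ge[y _ yc].
    have : y \in C by rewrite inE.
    by rewrite (cards0_eq Cn) inE.
  apply/seteqP; split=> // u; rewrite /sphere /= big_ord0 => /esym/eqP.
  by rewrite oner_eq0.
exists n.
pose c (i : 'I_n.+1) : L := enum_val (cast_ord (esym Cn) i).
have cc i : covers (c i) (\top%O : L).
  by have := enum_valP (cast_ord (esym Cn) i); rewrite inE.
have /choice[J JP] : forall i, exists j, forall x, (x <= c i)%O = ~~ (j <= x)%O.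
  by move=> i; exact: coatom_prime.
apply: (@coatoms_homotopy_equivalent _ _ _ n c J) => //.
  move=> y yc; have yC : y \in C by rewrite inE.
  exists (cast_ord Cn (enum_rank_in yC y)).
  by rewrite /c cast_ordK enum_rankK_in.
by move=> i j /enum_val_inj/cast_ord_inj.
Qed.

End Spherical.

Theorem theorem1p3 (R : realType) (d : Order.disp_t) (L : finTBLatticeType d)
    (L_cu : congruence_uniform L) :
  is_lattice (CLO L) <-> spherical R L /\ intersection_property L.
Proof.
have [[cg_inj _] _] := L_cu; rewrite CLO_lattice_iff //.
by split=> -[h ip]; split=> //; [exact: nucleus_spherical|exact: spherical_nucleus h].
Qed.
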